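(* Let $n\ge1$ and $s\in\{1,\dots,1+n\}$. The polynomials $\mathcal P(M_{\mathrm{red}})$ are dense in $\mathcal A(M_{\mathrm{red}})$.
   Context: Let $\nu_k=+1$ for $0\le k\le s-1$ and $\nu_k=-1$ for $s\le k\le n$. On $\mathbb C^{1+n}$ with standard coordinates $z^0,\dots,z^n$ put $J=\sum_{k=0}^n\nu_k z^k\bar z^k$, $Z=J^{-1}(\{1\})$ and $M_{\mathrm{red}}=Z/U(1)$ ($U(1)$ acting by scalar multiplication), identified with the open complex submanifold $\{[\rho]:J(\rho)>0\}$ of $\mathbb{CP}^n$. $\mathcal P(M_{\mathrm{red}})$ is the set of functions of the form $[\rho]\mapsto p(\rho)$ ($\rho\in Z$) with $p$ a $U(1)$-invariant polynomial (complex coefficients) in $z^0,\dots,z^n,\bar z^0,\dots,\bar z^n$. Let $\hat J(\xi,\eta)=\sum_{k=0}^n\nu_k\xi^k\eta^k$ on $\mathbb C^{1+n}\times\mathbb C^{1+n}$, $\hat Z=\hat J^{-1}(\{1\})$ and $\hat M_{\mathrm{red}}=\hat Z/\mathbb C^*$, where $\alpha\in\mathbb C^*$ acts by $(\xi,\eta)\mapsto(\alpha\xi,\alpha^{-1}\eta)$; this is a complex manifold, identified with the open subset $\{([\xi],[\eta]):\hat J(\xi,\eta)\neq0\}$ of $\mathbb{CP}^n\times\mathbb{CP}^n$. Let $\Delta_{\mathrm{red}}:M_{\mathrm{red}}\to\hat M_{\mathrm{red}}$, $[\rho]\mapsto[(\rho,\bar\rho)]$ for $\rho\in Z$. Then $\mathcal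 A(M_{\mathrm{red}})=\{\hat g\circ\Delta_{\mathrm{red}}:\hat g\in\mathcal O(\hat M_{\mathrm{red}})\}$, where $\mathcal O$ denotes holomorphic functions, with the Fréchet topology of locally uniform convergence of the (unique) holomorphic extensions $\hat g$ on $\hat M_{\mathrm{red}}$. *)

(* Defs.v *)
From HB Require Import structures.
From mathcomp Require Import all_boot all_order all_algebra.
From mathcomp Require Import generic_quotient complex.
From mathcomp Require Import all_classical all_reals all_analysis.
From mathcomp Require mpoly.

Set Implicit Arguments.
Unset Strict Implicit.
Unset Printing Implicit Defensive.

Import Order.TTheory GRing.Theory Num.Theory.
Import numFieldNormedType.Exports.

Local Open Scope classical_set_scope.
Local Open Scope ring_scope.
Local Open Scope quotient_scope.

(* The type must be a numClosedFieldType, and not merely R[i], for the topology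
   and the normed module structure over itself to be inferred; "differentiable"
   between normed modules over CC R is complex differentiability. *)
Definition CC (R : realType) : numClosedFieldType := R[i].

Definition nu (R : realType) (n s : nat) (k : 'I_n.+1) : CC R :=
  if (k < s)%N then 1 else -1.

Definition conj_row (R : realType) (m : nat) (z : 'rV[CC R]_m) : 'rV[CC R]_m :=
  map_mx Num.conj z.

Definition J (R : realType) (n s : nat) (z : 'rV[CC R]_n.+1) : CC R :=
  \sum_(k < n.+1) nu R s k * z 0 k * (z 0 k)^*.

Definition Jhat (R : realType) (n s : nat) (xi eta : 'rV[CC R]_n.+1) : CC R :=
  \sum_(k < n.+1) nu R s k * xi 0 k * eta 0 k.

Definition Z (R : realType) (n s : nat) : set 'rV[CC R]_n.+1 :=
  [set z | J s z = 1].
Arguments Z : clear implicits.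

Definition Zhat (R : realType) (n s : nat) :
    set ('rV[CC R]_n.+1 * 'rV[CC R]_n.+1) :=
  [set x | Jhat s x.1 x.2 = 1].
Arguments Zhat : clear implicits.

Section Quotients.
Context (R : realType) (n s : nat).

Definition U1_rel (z w : Z R n s) : bool :=
  `[< exists a : CC R, `|a| = 1 /\ sval w = a *: sval z >].

Lemma U1_rel_refl : reflexive U1_rel.
Proof. by move=> z; apply/asboolP; exists 1; rewrite normr1 scale1r. Qed.

Lemma U1_rel_sym : symmetric U1_rel.
Proof.
have H z w : U1_rel z w -> U1_rel w z.
  move=> /asboolP[a [a1 Ha]]; apply/asboolP; exists a^-1.
  have a0 : a != 0 by rewrite -normr_eq0 a1 oner_neq0.
  by rewrite Ha normfV a1 invr1 scalerA mulVf// scale1r.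
by move=> z w; apply/idP/idP; apply: H.
Qed.

Lemma U1_rel_trans : transitive U1_rel.
Proof.
move=> y x z /asboolP[a [a1 Ha]] /asboolP[b [b1 Hb]]; apply/asboolP.
by exists (b * a); rewrite normrM a1 b1 mulr1 Hb Ha scalerA.
Qed.

Definition U1_equiv := EquivRel U1_rel U1_rel_refl U1_rel_sym U1_rel_trans.

Definition Mred := {eq_quot U1_equiv}.
HB.instance Definition _ := Quotient.on Mred.
HB.instance Definition _ := Choice.on Mred.

Definition Cstar_rel (x y : Zhat R n s) : bool :=
  `[< exists a : CC R,
        a != 0 /\ sval y = (a *: (sval x).1, a^-1 *: (sval x).2) >].

Lemma Cstar_rel_refl : reflexive Cstar_rel.
Proof.
move=> x; apply/asboolP; exists 1.
by rewrite oner_neq0 invr1 !scale1r -surjective_pairing.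
Qed.

Lemma Cstar_rel_sym : symmetric Cstar_rel.
Proof.
have H x y : Cstar_rel x y -> Cstar_rel y x.
  move=> /asboolP[a [a0 Ha]]; apply/asboolP; exists a^-1.
  by rewrite Ha invr_neq0// !scalerA invrK mulVf// mulfV// !scale1r
     -surjective_pairing.
by move=> x y; apply/idP/idP; apply: H.
Qed.

Lemma Cstar_rel_trans : transitive Cstar_rel.
Proof.
move=> y x z /asboolP[a [a0 Ha]] /asboolP[b [b0 Hb]]; apply/asboolP.
by exists (b * a); rewrite mulf_neq0// Hb Ha !scalerA invfM.
Qed.

Definition Cstar_equiv :=
  EquivRel Cstar_rel Cstar_rel_refl Cstar_rel_sym Cstar_rel_trans.

Definition Mhat := {eq_quot Cstar_equiv}.
HB.instance Definition _ := Topological.copy Mhat (quotient_topology Mhat).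
HB.instance Definition _ := Quotient.on Mhat.

(* The point ([xi], [eta]) of the open subset Jhat != 0 of CP^n x CP^n, as an
   orbit in Mhat: the representative with Jhat = 1 is (xi / Jhat(xi, eta), eta)
   up to the action of C^*.  It is None exactly when Jhat(xi, eta) = 0. *)
Definition Mhat_point (xi eta : 'rV[CC R]_n.+1) : option Mhat :=
  omap (\pi_Mhat) (insub ((Jhat s xi eta)^-1 *: xi, eta)).

(* Homogeneous coordinates of the point of CP^n with coordinates u in the
   affine chart z^i != 0: the i-th one is 1, the others are those of u. *)
Definition affine (i : 'I_n.+1) (u : 'rV[CC R]_n) : 'rV[CC R]_n.+1 :=
  \row_k oapp (u 0) 1 (unlift i k).

(* The affine charts of CP^n x CP^n give an atlas of the complex manifold Mhat.
   The value 0 outside the domain (which is open) of a chart is irrelevant. *)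
Definition holomorphic (g : Mhat -> CC R) : Prop :=
  forall (i j : 'I_n.+1) (w : 'rV[CC R]_n * 'rV[CC R]_n),
    Jhat s (affine i w.1) (affine j w.2) != 0 ->
    differentiable
      (fun w' : 'rV[CC R]_n * 'rV[CC R]_n =>
         oapp g 0 (Mhat_point (affine i w'.1) (affine j w'.2)) : CC R) w.

Lemma Delta_subproof (z : Z R n s) :
  (sval z, conj_row (sval z)) \in Zhat R n s.
Proof.
case: z => z /= /[!inE]; rewrite /Z /Zhat /= => <-.
by apply: eq_bigr => k _; rewrite mxE.
Qed.

Definition Delta (z : Z R n s) : Zhat R n s :=
  exist _ (sval z, conj_row (sval z)) (Delta_subproof z).

Definition Delta_red (m : Mred) : Mhat := \pi_Mhat (Delta (repr m)).

Lemma Delta_redE (z : Z R n s) :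
  Delta_red (\pi_Mred z) = \pi_Mhat (Delta z).
Proof.
rewrite /Delta_red; apply/eqmodP => /=.
case: piP => y /eqmodP /asboolP[a [a1 Ha]]; apply/asboolP; exists a^-1.
have a0 : a != 0 by rewrite -normr_eq0 a1 oner_neq0.
split; first exact: invr_neq0.
have aV : a^* = a^-1.
  apply: (mulfI a0); rewrite mulfV// -normCK a1 expr1n //.
rewrite /= Ha scalerA mulVf// scale1r invrK; congr pair.
apply/rowP => k; rewrite !mxE rmorphM /= aV mulrA mulfV// mul1r //.
Qed.

(* The value p(z, conj z) of a polynomial in z^0, ..., z^n and their
   conjugates: the last n + 1 of the 2(n + 1) formal variables stand for the
   conjugates. *)
Definition poly_eval (p : mpoly.mpoly (n.+1 + n.+1) (CC R))
    (z : 'rV[CC R]_n.+1) : CC R :=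
  mpoly.meval (row_mx z (conj_row z) 0) p.

Definition U1_invariant (p : mpoly.mpoly (n.+1 + n.+1) (CC R)) : Prop :=
  forall (a : CC R) (z : 'rV[CC R]_n.+1),
    `|a| = 1 -> poly_eval p (a *: z) = poly_eval p z.

Definition calP : set (Mred -> CC R) :=
  [set f | exists2 p : mpoly.mpoly (n.+1 + n.+1) (CC R), U1_invariant p &
     forall z : Z R n s, f (\pi_Mred z) = poly_eval p (sval z)].

(* O(Mhat) with the topology of uniform convergence on compact sets, which on
   the locally compact space Mhat is locally uniform convergence; as a subset
   type it carries the induced topology. *)
Definition calO : set {family compact, Mhat -> CC R} :=
  [set g | holomorphic g].

Definition calA : set (Mred -> CC R) :=
  [set g \o Delta_red | g in holomorphic].

Definition A_space : Type := calA.

Lemma restrict_subproof (g : calO) :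
  (sval g : Mhat -> CC R) \o Delta_red \in calA.
Proof. by case: g => g /= /[!inE] hg; exists g. Qed.

Definition restrict (g : calO) : A_space :=
  exist _ ((sval g : Mhat -> CC R) \o Delta_red) (restrict_subproof g).

(* Holomorphic extensions to Mhat being unique, restrict is a bijection from
   O(Mhat) onto A(Mred); A(Mred) carries the topology transported along it. *)
Definition A_open (U : set A_space) : Prop := open (restrict @^-1` U).

Lemma A_openT : A_open setT.
Proof. by rewrite /A_open preimage_setT; exact: openT. Qed.

Lemma A_openI : setI_closed A_open.
Proof. by move=> U V oU oV; exact: openI. Qed.

Lemma A_open_bigcup (I : Type) (U : I -> set A_space) :
  (forall i, A_open (U i)) -> A_open (\bigcup_i U i).
Proof. by move=> oU; apply: bigcup_open => i _; exact: oU. Qed.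

HB.instance Definition _ := Choice.copy A_space (set_type calA).
HB.instance Definition _ :=
  isOpenTopological.Build A_space A_openT A_openI A_open_bigcup.

End Quotients.

Arguments calP : clear implicits.
Arguments calA : clear implicits.
Arguments A_space : clear implicits.

(* Main.v *)
(* Points of Mhat are written ([xi], [eta]) with Jhat(xi, eta) = 1, and a
   holomorphic function g on Mhat is a function of (xi, eta) that is invariant
   under the action of C^*.  For fixed xi_k, eta_k (k > 0) the pair
   (xi_0, eta_0) moves on the conic xi_0 eta_0 = t, where t is a polynomial in
   the other coordinates.  On this conic g is a Laurent series: a power series
   in xi_0 plus a power series in eta_0, and, the other coordinates being free,
   its coefficients are entire functions on C^(2n), hence limits of
   polynomials.  Averaging over U(1) makes the approximating polynomials
   invariant, and every compact subset of Mhat is represented by bounded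
   (xi, eta).

   In place of Laurent and Taylor coefficients we use interpolation at roots of
   unity, whose coefficients are values of the function and therefore clearly
   holomorphic in the other variables.  The interpolation error is controlled
   by Cauchy's formula, which is proved without integrals: the mean of f over
   2^N equidistant points of a circle is asymptotically independent of the
   radius, by Goursat's bisection argument applied to Riemann sums along the
   boundary of a dyadic square (the image of polar coordinates).  These sums
   vanish exactly on affine functions. *)

Require Import Defs.
From mathcomp Require Import all_boot all_order all_algebra.
From mathcomp Require Import generic_quotient complex.
From mathcomp Require Import all_classical all_reals all_analysis.
From mathcomp Require Import ring lra zify.
From mathcomp Require mpoly.
Import -(notations) mpoly.

Set Implicit Arguments.
Unset Strict Implicit.
Unset Printing Implicit Defensive.

Import Order.TTheory GRing.Theory Num.Theory.
Import numFieldNormedType.Exports.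

Local Open Scope classical_set_scope.
Local Open Scope ring_scope.
Local Open Scope quotient_scope.

(** * Complex modulus *)

(** Cauchy's formula has to precede everything usually derived from it. In particular the quotient
    (f w - f z) / (w - z) is only known to be continuous at z, so Goursat's argument must tolerate a
    point without derivative. There the boundary sum of a square of side h is o(h) instead of
    o(h^2); the bisection therefore compares it not with the area but with an additive [gauge] that
    is at least h on squares containing the point.

    Interpolation errors are estimated by duality: such an error is a finite combination of values
    of f, and [cauchy_dual] bounds it through the same combination of Cauchy kernels on two circles.
    Only the maximum of f enters; the rest concerns explicit rational functions. Evaluation points
    of modulus at most B, nodes of modulus 4B and a circle of radius 12B give errors of order 2^-M
    for M nodes. The inner circle is the image of the outer one under xi_0 -> t / xi_0, so both
    coordinates stay within 12B and the bound is uniform in t. At t = 0 the conic is a pair of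
    lines, treated separately. *)

Section ComplexModulus.
Context {R : realType}.
Implicit Types (x y z : CC R) (a b e d : R).

(** The norm on [CC R] takes values in [CC R] itself; its real part moves all estimates into the
    totally ordered field [R]. *)
Definition modc x : R := complex.Re `|x|.

Definition ofR (a : R) : CC R := real_complex R a.

Lemma modcE x : `|x| = ofR (modc x).
Proof. by rewrite /modc normc_def. Qed.

Lemma ofR_le (a b : R) : (ofR a <= ofR b) = (a <= b).
Proof. exact: lecR. Qed.

Lemma ofR_lt (a b : R) : (ofR a < ofR b) = (a < b).
Proof. exact: ltcR. Qed.

Lemma ofRD a b : ofR (a + b) = ofR a + ofR b. Proof. exact: rmorphD. Qed.
Lemma ofRB a b : ofR (a - b) = ofR a - ofR b. Proof. exact: rmorphB. Qed.
Lemma ofRN a : ofR (- a) = - ofR a. Proof. exact: rmorphN. Qed.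
Lemma ofRM a b : ofR (a * b) = ofR a * ofR b. Proof. exact: rmorphM. Qed.
Lemma ofRV a : ofR a^-1 = (ofR a)^-1. Proof. exact: fmorphV. Qed.
Lemma ofR1 : ofR 1 = 1. Proof. exact: rmorph1. Qed.
Lemma ofR0 : ofR 0 = 0. Proof. exact: rmorph0. Qed.
Lemma ofR_nat n : ofR n%:R = n%:R. Proof. exact: rmorph_nat. Qed.
Lemma ofRX a n : ofR (a ^+ n) = ofR a ^+ n. Proof. exact: rmorphXn. Qed.
Lemma ofR_inj : injective ofR. Proof. exact: complexI. Qed.

Lemma modcM x y : modc (x * y) = modc x * modc y.
Proof. by apply: ofR_inj; rewrite ofRM -!modcE normrM. Qed.

Lemma modc_ge0 x : 0 <= modc x.
Proof. by rewrite -ofR_le ofR0 -modcE. Qed.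

Lemma modcD x y : modc (x + y) <= modc x + modc y.
Proof. by rewrite -ofR_le ofRD -!modcE ler_normD. Qed.

Lemma modcN x : modc (- x) = modc x.
Proof. by rewrite /modc normrN. Qed.

Lemma modcB x y : modc (x - y) <= modc x + modc y.
Proof. by rewrite -(modcN y) modcD. Qed.

Lemma modc_subC x y : modc (x - y) = modc (y - x).
Proof. by rewrite -modcN opprB. Qed.

Lemma modcV x : modc x^-1 = (modc x)^-1.
Proof. by apply: ofR_inj; rewrite ofRV -!modcE normfV. Qed.

Lemma modcX x n : modc (x ^+ n) = modc x ^+ n.
Proof. by apply: ofR_inj; rewrite ofRX -!modcE normrX. Qed.

Lemma modc0 : modc 0 = 0. Proof. by rewrite /modc normr0. Qed.
Lemma modc1 : modc 1 = 1. Proof. by rewrite /modc normr1. Qed.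

Lemma modc_eq0 x : (modc x == 0) = (x == 0).
Proof. by rewrite -(inj_eq ofR_inj) ofR0 -modcE normr_eq0. Qed.

Lemma modc_gt0 x : (0 < modc x) = (x != 0).
Proof. by rewrite lt0r modc_ge0 andbT modc_eq0. Qed.

Lemma modc_ofR a : modc (ofR a) = `|a|.
Proof.
apply: ofR_inj; rewrite -modcE.
have [a0|/ltW a0] := leP 0 a; rewrite ?(ger0_norm a0) ?(ler0_norm a0).
  by rewrite ger0_norm // -ofR0 ofR_le.
by rewrite ofRN ler0_norm // -ofR0 ofR_le.
Qed.

Lemma modc_nat n : modc n%:R = n%:R.
Proof. by rewrite -ofR_nat modc_ofR ger0_norm. Qed.

Lemma modc_sum (I : Type) (r : seq I) (P : pred I) (F : I -> CC R) :
  modc (\sum_(i <- r | P i) F i) <= \sum_(i <- r | P i) modc (F i).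
Proof.
elim/big_rec2: _ => [|i y x _ h]; first by rewrite modc0.
by apply: le_trans (modcD _ _) _; rewrite lerD2l.
Qed.

Lemma modc_distl x y : modc x - modc y <= modc (x - y).
Proof. by rewrite lerBlDr; apply: le_trans (modcD _ _); rewrite subrK. Qed.

Lemma modc_lt x (e : R) : (`|x| < ofR e) = (modc x < e).
Proof. by rewrite modcE ofR_lt. Qed.

(** The differential is linear over [CC R], hence multiplication by its value [a] at 1. *)
Lemma diff_eps (f : CC R -> CC R) z : differentiable f z ->
  exists a : CC R, forall e : R, 0 < e -> exists2 d : R, 0 < d &
    forall w, modc (w - z) < d ->
      modc (f w - f z - a * (w - z)) <= e * modc (w - z).
Proof.
move=> df; exists ('d f z 1) => e e0.
have := diff_locally df => /eqaddoP /(_ (ofR e)).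
rewrite -ofR0 ofR_lt => /(_ e0) /nbhs_norm0P [d d0 H].
have {}H (y : CC R) : `|y| < (d : CC R) ->
  `|f (y + z) - (f z + 'd f z y)| <= ofR e * `|y| := H y.
have Ed : d = ofR (modc d) by rewrite -modcE gtr0_norm.
exists (modc d); first by rewrite -ofR_lt -Ed ofR0.
move=> w wd; have := H (w - z).
rewrite {1}Ed modc_lt => /(_ wd).
rewrite modcE [`|w - z|]modcE -ofRM ofR_le subrK.
suff -> : 'd f z (w - z) = 'd f z 1 * (w - z) by rewrite opprD addrA.
by rewrite -{1}(mulr1 (w - z)) -[(w - z) * 1]/((w - z) *: (1 : (CC R)^o)) linearZ /= mulrC.
Qed.

End ComplexModulus.

(** * Goursat's bisection argument for Riemann sums *)

Section DiscreteGoursat.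
Context {R : realType}.
Implicit Types (s t h x y d e : R).

Lemma nested_intervals (a h : nat -> R) :
  (forall k, a k <= a k.+1) -> (forall k, a k.+1 + h k.+1 <= a k + h k) ->
  (forall k, 0 <= h k) -> exists x, forall k, a k <= x <= a k + h k.
Proof.
move=> ha hb h0.
have ma : {homo a : i j / (i <= j)%N >-> i <= j}.
  by apply: homo_leq => //; exact: le_trans.
have mb : {homo (fun k => a k + h k) : i j / (i <= j)%N >-> j <= i}.
  apply: (@homo_leq _ _ (fun x y => y <= x)) => //.
  by move=> y x z xy yz; exact: le_trans yz xy.
have H i j : a i <= a j + h j.
  apply: (@le_trans _ _ (a (maxn i j))); first by rewrite ma // leq_maxl.
  apply: (@le_trans _ _ (a (maxn i j) + h (maxn i j))); first by rewrite lerDl.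
  by rewrite mb // leq_maxr.
exists (sup (range a)) => k; apply/andP; split.
  apply: ub_le_sup; last by exists k.
  by exists (a 0%N + h 0%N) => _ [i _ <-].
apply: ge_sup; first by exists (a 0%N), 0%N.
by move=> _ [i _ <-].
Qed.

(** Left endpoints and a power of two of equal steps: halving the interval then splits the sum
    exactly, as it would an integral. *)
Definition riemann N (g : R -> CC R) a h : CC R :=
  \sum_(0 <= j < 2 ^ N) g (a + j%:R * (h / 2 ^+ N)) * ofR (h / 2 ^+ N).

Lemma riemannS N g a h :
  riemann N.+1 g a h = riemann N g a (h / 2) + riemann N g (a + h / 2) (h / 2).
Proof.
have E2 : (2 : R) ^+ N != 0 by rewrite expf_neq0 // pnatr_eq0.
rewrite /riemann expnS mul2n -addnn (big_cat_nat (n := 2 ^ N)) ?leq_addr //=.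
congr (_ + _).
  by apply: eq_bigr => j _; rewrite exprS; congr (g (_ + _ * _) * ofR _);
    field.
rewrite -{1}[X in bigop _ (index_iota X _)](add0n (2 ^ N)%N) big_addn addnK.
apply: eq_bigr => j _; congr (g _ * ofR _); rewrite exprS ?natrD ?natrX; by field.
Qed.

Variables (phi : R -> R -> CC R) (u v : CC R).

(** Riemann sum of the form phi (u ds + v dt) along the counterclockwise boundary of the square with
    corner (s, t) and side h. In polar coordinates u ds + v dt will be the pullback of dw / w. *)
Definition bdry N s t h : CC R :=
  u * riemann N (fun x => phi x t) s h - u * riemann N (fun x => phi x (t + h)) s h
  + v * riemann N (fun y => phi (s + h) y) t h - v * riemann N (phi s) t h.

Lemma bdryS N s t h : bdry N.+1 s t h =
  bdry N s t (h / 2) + bdry N (s + h / 2) t (h / 2)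
  + bdry N s (t + h / 2) (h / 2) + bdry N (s + h / 2) (t + h / 2) (h / 2).
Proof.
have E x : x + h / 2 + h / 2 = x + h by field.
by rewrite /bdry !riemannS !E; ring.
Qed.

Definition edges s t h x y : CC R :=
  u * (phi x t - phi x (t + h)) + v * (phi (s + h) y - phi s y).

Lemma bdryE N s t h : bdry N s t h = \sum_(0 <= j < 2 ^ N)
  edges s t h (s + j%:R * (h / 2 ^+ N)) (t + j%:R * (h / 2 ^+ N))
   * ofR (h / 2 ^+ N).
Proof.
rewrite /bdry /riemann !big_distrr /= -!sumrB -!big_split /= -sumrB.
by apply: eq_bigr => j _; rewrite /edges; ring.
Qed.

(** Replacing phi by its difference p from an affine function of x u + y v changes no summand: in
    [edges] the horizontal pair contributes - a u v h and the vertical pair a u v h. Each remaining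
    value of p is at most K. *)
Lemma bdry_bound N s t h (K : R) (c a : CC R) : 0 <= h ->
  (forall x y, s <= x <= s + h -> t <= y <= t + h ->
    modc (phi x y - (c + a * (ofR x * u + ofR y * v))) <= K) ->
  modc (bdry N s t h) <= 2 * (modc u + modc v) * K * h.
Proof.
move=> h0 HK; rewrite bdryE.
set d := h / 2 ^+ N.
have E2 : 0 < (2 : R) ^+ N by rewrite exprn_gt0.
have d0 : 0 <= d by rewrite divr_ge0 // ltW.
have dh : (2 ^ N)%N%:R * d = h by rewrite natrX /d; field; rewrite gt_eqF.
apply: le_trans (modc_sum _ _ _) _.
have -> : 2 * (modc u + modc v) * K * h =
    \sum_(0 <= j < 2 ^ N) (2 * (modc u + modc v) * K * d).
  by rewrite sumr_const_nat subn0 -mulr_natl -{1}dh; ring.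
rewrite big_seq [leRHS]big_seq; apply: ler_sum => j.
rewrite mem_index_iota /= => jN.
rewrite modcM modc_ofR ger0_norm //; apply: ler_wpM2r => //.
have jd : 0 <= j%:R * d <= h.
  rewrite mulr_ge0 //= -dh ler_wpM2r // ler_nat; exact: ltnW.
set x := s + _; set y := t + _.
have xI : s <= x <= s + h by rewrite /x; lra.
have yI : t <= y <= t + h by rewrite /y; lra.
pose p x y := phi x y - (c + a * (ofR x * u + ofR y * v)).
have -> : edges s t h x y =
    u * (p x t - p x (t + h)) + v * (p (s + h) y - p s y).
  by rewrite /edges /p !ofRD; ring.
apply: le_trans (modcD _ _) _; rewrite !modcM.
have -> : 2 * (modc u + modc v) * K = modc u * (K + K) + modc v * (K + K) by ring.
have sI : s <= s <= s + h by lra.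
have sI' : s <= s + h <= s + h by lra.
have tI : t <= t <= t + h by lra.
have tI' : t <= t + h <= t + h by lra.
by apply: lerD; apply: ler_wpM2l; rewrite ?modc_ge0 //;
  apply: le_trans (modcB _ _) _; apply: lerD; apply: HK.
Qed.

Variables (A B : R -> R).
Hypothesis incA : forall x y, x <= y -> y - x <= A y - A x.
Hypothesis incB : forall x y, x <= y -> y - x <= B y - B x.

(** The area of the square for the product of the measures dA and dB. It is additive under bisection
    and at least the usual area, and A, B can be made steep near an exceptional point. *)
Definition gauge s t h : R := (A (s + h) - A s) * (B (t + h) - B t).

Lemma gaugeS s t h : gauge s t h =
  gauge s t (h / 2) + gauge (s + h / 2) t (h / 2)
  + gauge s (t + h / 2) (h / 2) + gauge (s + h / 2) (t + h / 2) (h / 2).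
Proof.
have E x : x + h / 2 + h / 2 = x + h by field.
by rewrite /gauge !E; ring.
Qed.

Lemma gauge_ge s t h : 0 <= h -> h * h <= gauge s t h.
Proof.
move=> h0; have hA := incA (_ : s <= s + h); have hB := incB (_ : t <= t + h).
by apply: ler_pM => //; [have := hA | have := hB]; rewrite lerDl => /(_ h0); lra.
Qed.

(** The real differential of phi is a multiple of u ds + v dt: the Cauchy-Riemann condition in the
    coordinates (s, t). *)
Definition diff_at s0 t0 := exists a : CC R, forall e, 0 < e ->
  exists2 d, 0 < d & forall s t, `|s - s0| < d -> `|t - t0| < d ->
    modc (phi s t - phi s0 t0 - a * (ofR (s - s0) * u + ofR (t - t0) * v))
      <= e * (`|s - s0| + `|t - t0|).

Definition cont_at s0 t0 := forall e, 0 < e ->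
  exists2 d, 0 < d & forall s t, `|s - s0| < d -> `|t - t0| < d ->
    modc (phi s t - phi s0 t0) <= e.

(** The second alternative is the exceptional point: continuity gives a boundary sum o(h) only, and
    the gauge of every square around the point compensates for the missing factor h. *)
Hypothesis regular : forall s0 t0, 0 <= s0 <= 1 -> 0 <= t0 <= 1 ->
  diff_at s0 t0 \/ (cont_at s0 t0 /\
    forall s t h, 0 <= h -> s <= s0 <= s + h -> t <= t0 <= t + h ->
      h <= gauge s t h).

Section Bisection.
Variable e : R.
Hypothesis e0 : 0 < e.

(** Badness is asked for arbitrarily fine subdivisions because each bisection lowers N by one; in
    this form it passes to a quarter of the square. *)
Definition bad s t h := forall N0, exists2 N, (N0 <= N)%N &
  e * gauge s t h < modc (bdry N s t h).

Lemma badS s t h : bad s t h -> [\/ bad s t (h / 2), bad (s + h / 2) t (h / 2),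
  bad s (t + h / 2) (h / 2) | bad (s + h / 2) (t + h / 2) (h / 2)].
Proof.
move=> bd; apply: contrapT => nb.
have good s' t' : ~ bad s' t' (h / 2) -> exists N0, forall N, (N0 <= N)%N ->
    modc (bdry N s' t' (h / 2)) <= e * gauge s' t' (h / 2).
  move=> nbad; apply: contrapT => H; apply: nbad => N0.
  apply: contrapT => H'; apply: H; exists N0 => N N0N.
  by rewrite leNgt; apply/negP => H; apply: H'; exists N.
have [N1 H1] := good _ _ (fun b => nb (Or41 _ _ _ b)).
have [N2 H2] := good _ _ (fun b => nb (Or42 _ _ _ b)).
have [N3 H3] := good _ _ (fun b => nb (Or43 _ _ _ b)).
have [N4 H4] := good _ _ (fun b => nb (Or44 _ _ _ b)).
(* The successor pays for the level that [bdryS] consumes. *)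
have [[//|N] ] := bd (N1 + N2 + N3 + N4).+1.
rewrite ltnS => NN; apply/negP; rewrite -leNgt bdryS gaugeS !mulrDr.
have := H1 N; have := H2 N; have := H3 N; have := H4 N.
do 4 (move=> /(_ ltac:(lia)) ?).
do 3 (apply: le_trans (modcD _ _) _; apply: lerD => //).
Qed.

Definition next_square (p : R * R) h : R * R :=
  if `[< bad p.1 p.2 h >] then (p.1, p.2)
  else if `[< bad (p.1 + h) p.2 h >] then (p.1 + h, p.2)
  else if `[< bad p.1 (p.2 + h) h >] then (p.1, p.2 + h)
  else (p.1 + h, p.2 + h).

Fixpoint square k : R * R :=
  if k is k'.+1 then next_square (square k') (2 ^- k'.+1) else (0, 0).

Lemma square_bad : bad 0 0 1 -> forall k,
  bad (square k).1 (square k).2 (2 ^- k).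
Proof.
move=> b0; elim=> [|k IH] /=; first by rewrite expr0 invr1.
have E : 2 ^- k.+1 = 2 ^- k / 2 :> R by rewrite exprSr invfM.
rewrite /next_square E; have [] := badS IH => Hb.
- by rewrite (asboolT Hb).
- by case: ifP => [/asboolP //|_]; rewrite (asboolT Hb).
- by case: ifP => [/asboolP //|_]; case: ifP => [/asboolP //|_];
    rewrite (asboolT Hb).
- by do 3 (case: ifP => [/asboolP //|_]).
Qed.

Lemma square_step k (S := square k) (S' := square k.+1) (h := 2 ^- k.+1 : R) :
  S.1 <= S'.1 <= S.1 + h /\ S.2 <= S'.2 <= S.2 + h.
Proof.
have h0 : 0 <= h by rewrite invr_ge0 exprn_ge0.
by rewrite {}/S' /= /next_square -/S -/h; do 3 ?case: ifP => _ /=; lra.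
Qed.

Lemma not_bad : ~ bad 0 0 1.
Proof.
move=> /square_bad bd.
have hS k : 2 ^- k.+1 = 2 ^- k / 2 :> R by rewrite exprSr invfM.
have h0 k : 0 < 2 ^- k :> R by rewrite invr_gt0 exprn_gt0.
have [s0 Hs] : exists x, forall k, (square k).1 <= x <= (square k).1 + 2 ^- k.
  apply: nested_intervals => k; last exact: ltW.
    by have [/andP[]] := square_step k.
  by have [] := square_step k; have := hS k; lra.
have [t0 Ht] : exists x, forall k, (square k).2 <= x <= (square k).2 + 2 ^- k.
  apply: nested_intervals => k; last exact: ltW.
    by have [_ /andP[]] := square_step k.
  by have [_] := square_step k; have := hS k; lra.
have /= s01 := Hs 0%N; have /= t01 := Ht 0%N.
rewrite expr0 invr1 add0r in s01 t01.
have small d : 0 < d -> exists k, 2 ^- k < d :> R.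
  move=> d0; have [k _ /(_ k (leqnn _))] := near_infty_natSinv_expn_lt (PosNum d0).
  by exists k; rewrite -div1r.
set U := 2 * (modc u + modc v).
have U0 : 0 <= U by rewrite mulr_ge0 // addr_ge0 // modc_ge0.
have U1 : 0 <= 2 * U + 1 by lra.
have e0' := ltW e0.
(* At a differentiable point the boundary sum is at most U * (e / (2 * U + 1)) * 2h * h, below e *
   h^2 and thus below e times the gauge. At the other points the bound is U * (e / (U + 1)) * h,
   below e * h, and [Hg] applies. The summand 1 keeps the denominators positive. *)
case: (regular s01 t01) => [[a Ha]|[Hc Hg]].
  have [|d d0 Hd] := Ha (e / (2 * U + 1)); first by rewrite divr_gt0 //; lra.
  have [k kd] := small d d0.
  have [N _] := bd k 0%N; apply/negP; rewrite -leNgt.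
  have := Hs k; have := Ht k; have := h0 k.
  set s := (square k).1; set t := (square k).2; set h := 2 ^- k => hp th sh.
  have {}kd : h < d := kd.
clearbody h.
  apply: (@le_trans _ _ (U * (e / (2 * U + 1) * (2 * h)) * h)).
    apply: (@bdry_bound _ _ _ _ _
      (phi s0 t0 - a * (ofR s0 * u + ofR t0 * v)) a); first exact: ltW.
    move=> x y xI yI.
    have xs : `|x - s0| <= h by rewrite ler_norml; lra.
    have yt : `|y - t0| <= h by rewrite ler_norml; lra.
    apply: le_trans (_ : e / (2 * U + 1) * (`|x - s0| + `|y - t0|) <= _).
      have -> : phi x y - (phi s0 t0 - a * (ofR s0 * u + ofR t0 * v)
        + a * (ofR x * u + ofR y * v)) =
        phi x y - phi s0 t0 - a * (ofR (x - s0) * u + ofR (y - t0) * v).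
        by rewrite !ofRB; ring.
      by apply: Hd; lra.
    apply: ler_wpM2l; first exact: divr_ge0.
    lra.
  apply: (@le_trans _ _ (e * (h * h))); last first.
    by apply: ler_wpM2l; [lra | apply: gauge_ge; lra].
  have -> : U * (e / (2 * U + 1) * (2 * h)) * h =
    e * (h * h) * (2 * U / (2 * U + 1)) by field; lra.
  rewrite ler_piMr ?ler_pdivrMr; try lra.
  by rewrite !mulr_ge0 //; lra.
have [|d d0 Hd] := Hc (e / (U + 1)); first by rewrite divr_gt0 //; lra.
have [k kd] := small d d0.
have [N _] := bd k 0%N; apply/negP; rewrite -leNgt.
have := Hs k; have := Ht k; have := h0 k.
set s := (square k).1; set t := (square k).2; set h := 2 ^- k => hp th sh.
have {}kd : h < d := kd.
clearbody h.
apply: (@le_trans _ _ (U * (e / (U + 1)) * h)).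
  apply: (@bdry_bound _ _ _ _ _ (phi s0 t0) 0); first exact: ltW.
  move=> x y xI yI; rewrite mul0r addr0.
  by apply: Hd; rewrite ltr_norml; lra.
apply: (@le_trans _ _ (e * h)); last first.
  by apply: ler_wpM2l; [lra | apply: Hg; lra].
apply: ler_wpM2r; first lra.
by rewrite mulrCA ler_piMr ?ler_pdivrMr; lra.
Qed.

End Bisection.

Lemma discrete_Goursat e : 0 < e ->
  exists N0, forall N, (N0 <= N)%N -> modc (bdry N 0 0 1) <= e.
Proof.
move=> e0; have g0 : 1 <= gauge 0 0 1.
  by have := @gauge_ge 0 0 1 ler01; rewrite mulr1.
have e1 : 0 < e / gauge 0 0 1 by rewrite divr_gt0 //; lra.
have nb := not_bad e1.
apply: contrapT => H; apply: nb => N0.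
apply: contrapT => H'; apply: H; exists N0 => N N0N.
rewrite leNgt; apply/negP => H; apply: H'; exists N => //.
by rewrite divfK //; lra.
Qed.

End DiscreteGoursat.

(** * The parametrised unit circle and its roots of unity *)

Section UnitCircle.
Context {R : realType}.
Implicit Types (t x y d e : R).

Lemma ofR_real (a : R) : ofR a \is Num.real.
Proof. by rewrite realE -ofR0 !ofR_le le_total. Qed.

Definition expi x : CC R := ofR (cos x) + 'i * ofR (sin x).

Definition turn t : CC R := expi (2 * pi * t).

Lemma expiD x y : expi (x + y) = expi x * expi y.
Proof.
rewrite /expi cosD sinD ofRB ofRD !ofRM.
have i2 : 'i * 'i = -1 :> CC R by rewrite -expr2 sqrCi.
by ring: i2.
Qed.

Lemma turnD x y : turn (x + y) = turn x * turn y.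
Proof. by rewrite /turn mulrDr expiD. Qed.

Lemma turn0 : turn 0 = 1.
Proof. by rewrite /turn /expi mulr0 cos0 sin0 ofR1 ofR0 mulr0 addr0. Qed.

Lemma turn1 : turn 1 = 1.
Proof.
rewrite /turn /expi mulr1 mulr_natl cos2pi sin2pi.
by rewrite ofR1 ofR0 mulr0 addr0.
Qed.

Lemma modc_turn t : modc (turn t) = 1.
Proof.
apply: ofR_inj; rewrite -modcE ofR1; apply/eqP.
rewrite -(@eqrXn2 _ 2) ?normr_ge0 ?ler01 // expr1n.
by rewrite normC2_rect ?ofR_real // -!ofRX -ofRD cos2Dsin2 ofR1.
Qed.

Lemma turn_neq0 t : turn t != 0.
Proof. by rewrite -modc_gt0 modc_turn. Qed.

(** The cosine is injective on [0, pi]; the substitutions t -> 1 - t and t -> - t reduce to that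
    range. *)
Lemma turn_eq1 t : `|t| <= 1 -> turn t = 1 -> [\/ t = -1, t = 0 | t = 1].
Proof.
move=> t1 /(congr1 (fun z => 'Re z)).
rewrite Re_rect ?ofR_real // -ofR1 (Creal_ReP _ _) ?ofR_real //.
move=> /ofR_inj cos1.
have pi0 := @pi_gt0 R.
have half x : 0 <= x <= 2^-1 -> cos (2 * pi * x) = 1 -> x = 0.
  move=> x01 cx; have : 2 * pi * x = 0.
    apply: cos_inj; rewrite ?cos0 // in_itv /=; last by rewrite lexx ltW.
    by apply/andP; split; nra.
  by move/eqP; rewrite !mulf_eq0 (gt_eqF pi0) pnatr_eq0 /= => /eqP.
have unit x : 0 <= x <= 1 -> cos (2 * pi * x) = 1 -> x = 0 \/ x = 1.
  move=> x01 cx; case: (leP x 2^-1) => hx.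
    by left; apply: half => //; lra.
  right; suff : 1 - x = 0 by lra.
  apply: half; first by lra.
  transitivity (cos (2 * pi * x)); last by [].
  rewrite -cosN; have -> : - (2 * pi * (1 - x)) = 2 * pi * x - pi *+ 2.
    by rewrite -mulr_natl; ring.
  by rewrite -(cosD2pi (_ - _)) subrK.
case: (leP 0 t) => t0.
  rewrite ger0_norm // in t1.
  by have [||->|->] := unit t; [lra|by []|constructor 2|constructor 3].
rewrite ltr0_norm // in t1.
have [|||] := unit (- t); first lra.
- by rewrite mulrN cosN.
- by move=> ?; constructor 2; lra.
- by move=> ?; constructor 1; lra.
Qed.

Lemma turnX t n : turn t ^+ n = turn (n%:R * t).
Proof.
elim: n => [|n IH]; first by rewrite mul0r turn0.
by rewrite exprS IH -turnD; congr turn; rewrite -natr1; ring.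
Qed.

Lemma turn_prim N : (0 < N)%N -> N.-primitive_root (turn N%:R^-1).
Proof.
move=> N0; have N0' : (N%:R : R) != 0 by rewrite pnatr_eq0 -lt0n.
apply/andP; split=> //; apply/forallP => i; rewrite unity_rootE turnX.
apply/eqP; apply/idP/idP => [/eqP H|/eqP ->]; last by rewrite divff // turn1.
have i1 : (i.+1%:R / N%:R : R) <= 1.
  by rewrite ler_pdivrMr ?mul1r ?ler_nat ?ltr0n.
have i0 : 0 < (i.+1%:R / N%:R : R) by rewrite divr_gt0 ?ltr0n.
have [] := turn_eq1 _ H; first by rewrite gtr0_norm.
- by lra.
- by lra.
- by move=> /(congr1 ( *%R^~ N%:R)); rewrite divfK // mul1r => /eqP;
    rewrite eqr_nat.
Qed.

Lemma real_diff_eps (f : R -> R) x (a : R) : is_derive x 1 f a ->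
  forall e, 0 < e -> exists2 d, 0 < d & forall y, `|y - x| < d ->
    `|f y - f x - a * (y - x)| <= e * `|y - x|.
Proof.
move=> df e e0.
have dif : differentiable f x by apply/derivable1_diffP; case: df.
have := diff_locally dif => /eqaddoP /(_ e e0) /nbhs_norm0P [d d0 H].
exists d => // y yd; have := H (y - x) yd.
rewrite !fctE /= /shift /= subrK opprD addrA.
suff -> : 'd f x (y - x) = a * (y - x) by [].
rewrite -{1}(mulr1 (y - x)) -[(y - x) * 1]/((y - x) *: (1 : R^o)) linearZ /=.
by rewrite -deriveE // mulrC derive_val.
Qed.

Lemma turn_diff_eps x e : 0 < e -> exists2 d, 0 < d & forall y, `|y - x| < d ->
  modc (turn y - turn x - turn x * ('i * ofR (2 * pi)) * ofR (y - x))
    <= e * `|y - x|.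
Proof.
move=> e0.
have dl : is_derive x 1 ( *%R (2 * pi)) (2 * pi).
  have : is_derive x 1 ((2 * pi) \*: (@id R)) ((2 * pi) *: 1).
    exact: is_deriveZ.
  by rewrite -[_ *: _]/(_ * _) mulr1.
have dc : is_derive x 1 (fun y => cos (2 * pi * y)) (- sin (2 * pi * x) * (2 * pi)).
  exact: (is_derive1_comp (is_derive_cos _) dl).
have ds : is_derive x 1 (fun y => sin (2 * pi * y)) (cos (2 * pi * x) * (2 * pi)).
  exact: (is_derive1_comp (is_derive_sin _) dl).
have e2 : 0 < e / 2 by lra.
have [d1 d10 H1] := real_diff_eps dc e2.
have [d2 d20 H2] := real_diff_eps ds e2.
exists (Num.min d1 d2); first by rewrite lt_min d10.
move=> y; rewrite lt_min => /andP[/H1 {}H1 /H2 {}H2].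
have i2 : 'i * 'i = -1 :> CC R by rewrite -expr2 sqrCi.
have -> : turn y - turn x - turn x * ('i * ofR (2 * pi)) * ofR (y - x) =
  ofR (cos (2 * pi * y) - cos (2 * pi * x) - - sin (2 * pi * x) * (2 * pi) * (y - x))
  + 'i * ofR (sin (2 * pi * y) - sin (2 * pi * x)
      - cos (2 * pi * x) * (2 * pi) * (y - x)).
  by rewrite /turn /expi !(ofRB, ofRM, ofRN); ring: i2.
apply: le_trans (modcD _ _) _; rewrite modcM.
have -> : modc 'i = 1 :> R.
  by apply: ofR_inj; rewrite -modcE normCi ofR1.
rewrite mul1r !modc_ofR; lra.
Qed.

End UnitCircle.

(** * Means over circles *)

Section CircleMeans.
Context {R : realType}.
Implicit Types (s t h x y d e p l r : R).

Definition mean N (f : CC R -> CC R) (r : R) : CC R :=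
  (\sum_(0 <= j < 2 ^ N) f (ofR r * turn (j%:R / 2 ^+ N))) * ofR (2 ^- N).

(** An increasing function with infinite slope at p. Across an interval of length h around p it
    grows by at least the square root of h, so two such factors give a gauge of at least h. *)
Definition signed_root (p x : R) : R :=
  if p <= x then Num.sqrt (x - p) else - Num.sqrt (p - x).

Lemma signed_root_homo p : {homo signed_root p : x y / x <= y}.
Proof.
move=> x y xy; rewrite /signed_root.
case: (leP p x) => px; case: (leP p y) => py; try lra.
- by rewrite ler_wsqrtr //; lra.
- by have := sqrtr_ge0 (p - x); have := sqrtr_ge0 (y - p); lra.
- by rewrite lerN2 ler_wsqrtr //; lra.
Qed.

(** Subadditivity of the square root: a^2 + b^2 <= (a + b)^2 for the two partial roots a and b. *)
Lemma signed_root_incr p x h : 0 <= h -> x <= p <= x + h ->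
  Num.sqrt h <= signed_root p (x + h) - signed_root p x.
Proof.
move=> h0 xp; rewrite /signed_root; case/andP: (xp) => xp1 ->.
have -> : (if p <= x then Num.sqrt (x - p) else - Num.sqrt (p - x))
   = - Num.sqrt (p - x).
  case: (leP p x) => // px; have -> : x = p by lra.
  by rewrite subrr sqrtr0 oppr0.
rewrite opprK; set a := Num.sqrt (x + h - p); set b := Num.sqrt (p - x).
have a0 : 0 <= a := sqrtr_ge0 _; have b0 : 0 <= b := sqrtr_ge0 _.
have -> : h = a ^+ 2 + b ^+ 2 by rewrite !sqr_sqrtr //; lra.
rewrite -[leRHS]ger0_norm ?addr_ge0 // -sqrtr_sqr ler_wsqrtr //; nra.
Qed.

(** With an exponential radius, dP = P (l ds + 2 pi i dt) has constant coefficients relative to P;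
    these are the u and v of [bdry]. *)
Definition polar (x0 l : R) s t : CC R := ofR (expR (x0 + s * l)) * turn t.

Lemma polar_diff x0 l s0 t0 (P := polar x0 l) e : 0 < e ->
  exists2 d, 0 < d & forall s t, `|s - s0| < d -> `|t - t0| < d ->
    modc (P s t - P s0 t0
      - P s0 t0 * (ofR (s - s0) * ofR l + ofR (t - t0) * ('i * ofR (2 * pi))))
      <= e * (`|s - s0| + `|t - t0|).
Proof.
move=> e0; pose A s := expR (x0 + s * l).
have dA : is_derive s0 1 A (A s0 * l).
  have dl : is_derive s0 1 (fun s => x0 + s * l) l.
    have : is_derive s0 1 (cst x0 + l \*: (@id R)) (0 + l *: 1).
      by apply: is_deriveD; exact: is_deriveZ.
    rewrite -[_ *: _]/(_ * _) mulr1 add0r.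
    by have -> : cst x0 + l \*: id = (fun s => x0 + s * l) :> (R -> R)
      by apply/funext => s; rewrite (mulrC s).
  exact: (is_derive1_comp (is_derive_expR _) dl).
pose v : CC R := 'i * ofR (2 * pi); set M := A s0 + modc v + 1.
have A0 : 0 < A s0 by exact: expR_gt0.
have M0 : 0 < M by have := modc_ge0 v; rewrite /M; lra.
have Mv : modc v <= M by rewrite /M; lra.
pose k := A s0 * `|l| + 1.
have k0 : 0 < k by have := mulr_ge0 (ltW A0) (normr_ge0 l); rewrite /k; lra.
have [|d1 d10 H1] := real_diff_eps dA (e := Num.min 1 (e / 2)).
  by rewrite lt_min ltr01 /=; lra.
have [|d2 d20 H2] := turn_diff_eps t0 (e := e / (2 * M)).
  by rewrite divr_gt0 //; lra.
rewrite -/v in H2 *; clearbody v.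
(* Since A varies by at most k * |s - s0|, the bound [1 / k] keeps A s below M and the last one
   makes the variation at most e / (2 * M), as the cross term requires. *)
exists (Num.min (Num.min d1 d2) (Num.min (1 / k) (e / (2 * M * k)))).
  by rewrite !lt_min d10 d20 !divr_gt0 ?mulr_gt0.
move=> s t; rewrite !lt_min -!andbA => /and4P[/H1 {}H1 _ s1 s2].
move=> /and4P[_ /H2 {}H2 _ _].
have HA1 : `|A s - A s0 - A s0 * l * (s - s0)| <= `|s - s0|.
  apply: le_trans H1 _; by rewrite ler_piMl // ge_min lexx.
have HA2 : `|A s - A s0 - A s0 * l * (s - s0)| <= e / 2 * `|s - s0|.
  by apply: le_trans H1 _; rewrite ler_wpM2r // ge_min lexx orbT.
have HAk : `|A s - A s0| <= k * `|s - s0|.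
  rewrite /k mulrDl mul1r -[A s - A s0](subrK (A s0 * l * (s - s0))) addrC.
  apply: le_trans (ler_normD _ _) _; rewrite lerD //.
  by rewrite !normrM (gtr0_norm A0).
have HA3 : `|A s - A s0| <= 1.
  apply: le_trans HAk _; rewrite mulrC -ler_pdivlMr //; exact: ltW.
have HA4 : `|A s - A s0| <= e / (2 * M).
  apply: le_trans HAk _; rewrite mulrC -ler_pdivlMr //; apply: le_trans (ltW s2) _.
  by rewrite invfM mulrA.
have AM : `|A s| <= M.
  rewrite -[A s](subrK (A s0)); apply: le_trans (ler_normD _ _) _.
  by rewrite (gtr0_norm A0) /M; have := modc_ge0 v; lra.
(* Product rule with remainder: the error of [turn], the error of the radius, and the second-order
   cross term. *)
have -> : P s t - P s0 t0 - P s0 t0 * (ofR (s - s0) * ofR l + ofR (t - t0) * v)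
  = ofR (A s) * (turn t - turn t0 - turn t0 * v * ofR (t - t0))
  + turn t0 * ofR (A s - A s0 - A s0 * l * (s - s0))
  + turn t0 * (ofR (A s - A s0) * v * ofR (t - t0)).
  by rewrite /P /polar -!/(A _) !(ofRB, ofRM); ring.
apply: le_trans (modcD _ _) _.
apply: le_trans (lerD (modcD _ _) (lexx _)) _.
rewrite !modcM !modc_ofR !modc_turn !mul1r.
clearbody A M.
have T1 : `|A s| * modc (turn t - turn t0 - turn t0 * v * ofR (t - t0))
    <= e / 2 * `|t - t0|.
  apply: le_trans (_ : M * (e / (2 * M) * `|t - t0|) <= _).
    by apply: ler_pM => //; exact: modc_ge0.
  by have -> : M * (e / (2 * M) * `|t - t0|) = e / 2 * `|t - t0|
    by field; rewrite gt_eqF.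
have T3 : `|A s - A s0| * modc v * `|t - t0| <= e / 2 * `|t - t0|.
  apply: ler_wpM2r => //.
  apply: le_trans (_ : e / (2 * M) * M <= _).
    by apply: ler_pM => //; exact: modc_ge0.
  by have -> : e / (2 * M) * M = e / 2 by field; rewrite gt_eqF.
have := mulr_ge0 (ltW e0) (normr_ge0 (s - s0)); lra.
Qed.

Lemma polar_modc x0 l s t : modc (polar x0 l s t) = expR (x0 + s * l).
Proof. by rewrite modcM modc_turn mulr1 modc_ofR gtr0_norm // expR_gt0. Qed.

(** The Riemann sum of f(w) dw / w around the annulus, pulled back to the unit square: the two
    radial edges cancel by periodicity and the two circular ones are the means. The point z is the
    exceptional one, where only continuity is assumed. *)
Lemma circle_means_limit (f : CC R -> CC R) (z : CC R) (r1 r2 : R) :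
  0 < r1 < r2 ->
  (forall w, w != z -> r1 <= modc w <= r2 -> differentiable f w) ->
  (forall e, 0 < e -> exists2 d, 0 < d &
    forall w, modc (w - z) < d -> modc (f w - f z) <= e) ->
  forall e, 0 < e -> exists N0, forall N, (N0 <= N)%N ->
    modc (mean N f r2 - mean N f r1) <= e.
Proof.
move=> /andP[r10 r12] df cf e e0; have r20 : 0 < r2 by lra.
set l := ln r2 - ln r1.
have l0 : 0 < l by rewrite subr_gt0 ltr_ln.
pose P := polar (ln r1) l; pose phi s t := f (P s t).
have [v Ev] : exists v : CC R, 'i * ofR (2 * pi) = v by eexists.
have P0 t : P 0 t = ofR r1 * turn t by rewrite /P /polar mul0r addr0 lnK.
have P1 t : P 1 t = ofR r2 * turn t.
  by rewrite /P /polar mul1r /l addrC subrK lnK.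
have [A [B [incA incB HAB]]] : exists A B : R -> R,
   [/\ forall x y, x <= y -> y - x <= A y - A x,
      forall x y, x <= y -> y - x <= B y - B x &
      forall s0 t0, 0 <= s0 <= 1 -> 0 <= t0 <= 1 -> P s0 t0 = z ->
        forall s t h, 0 <= h -> s <= s0 <= s + h -> t <= t0 <= t + h ->
        h <= gauge A B s t h].
  case: (pselect (exists st : R * R, [/\ 0 <= st.1 <= 1, 0 <= st.2 <= 1 &
     P st.1 st.2 = z])) => [[[s1 t1] /= [s1I t1I Pz]]|nP]; last first.
    exists id, id; split => // s0 t0 sI tI Pz; case: nP; by exists (s0, t0).
  exists (fun x => x + signed_root s1 x).
  (* The angles 0 and 1 give the same point, so z may also be hit at t1 - 1 or t1 + 1; each possible
     angle gets its own root. *)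
  exists (fun x => x + (signed_root (t1 - 1) x + signed_root t1 x
     + signed_root (t1 + 1) x)).
  split.
  - by move=> x y xy; have := signed_root_homo s1 xy; lra.
  - move=> x y xy; have := signed_root_homo t1 xy.
    by have := signed_root_homo (t1 - 1) xy;
      have := signed_root_homo (t1 + 1) xy; lra.
  move=> s0 t0 s0I t0I Pz' s t h h0 sI tI.
  have Es : s0 = s1.
    have := congr1 modc (etrans Pz' (esym Pz)); rewrite !polar_modc.
    by move=> /expR_inj/addrI H; exact: (mulIf (lt0r_neq0 l0) H).
  have Et : turn (t0 - t1) = 1.
    apply: (mulIf (turn_neq0 t1)); rewrite -turnD subrK mul1r.
    move: (etrans Pz' (esym Pz)); rewrite Es /P /polar; apply: mulfI.
    by rewrite -modc_gt0 modc_ofR normr_gt0 gt_eqF // expR_gt0.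
  have th : t <= t + h by lra.
  have m1 := signed_root_homo t1 th; have m2 := signed_root_homo (t1 - 1) th.
  have m3 := signed_root_homo (t1 + 1) th.
  have rs : Num.sqrt h <= s + h + signed_root s1 (s + h) - (s + signed_root s1 s).
    by have := signed_root_incr h0 (p := s1) (x := s); rewrite -Es => /(_ sI); lra.
  have rt : Num.sqrt h <= t + h + (signed_root (t1 - 1) (t + h)
       + signed_root t1 (t + h) + signed_root (t1 + 1) (t + h))
     - (t + (signed_root (t1 - 1) t + signed_root t1 t + signed_root (t1 + 1) t)).
    have r := signed_root_incr h0 tI.
    have [||/eqP|/eqP] := turn_eq1 _ Et; first by rewrite ler_norml; lra.
    - move=> H; have E : t0 = t1 - 1 by lra.
      by move: r; rewrite E; lra.
    - by rewrite subr_eq0 => /eqP H; move: r; rewrite H; lra.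
    - by rewrite subr_eq => /eqP H; move: r; rewrite H (addrC 1); lra.
  rewrite /gauge -{1}(sqr_sqrtr h0) expr2.
  by apply: ler_pM => //; exact: sqrtr_ge0.
have reg s0 t0 : 0 <= s0 <= 1 -> 0 <= t0 <= 1 ->
  diff_at phi (ofR l) v s0 t0 \/ (cont_at phi s0 t0 /\
    forall s t h, 0 <= h -> s <= s0 <= s + h -> t <= t0 <= t + h ->
      h <= gauge A B s t h).
  move=> sI tI; have [p Ep] : exists p : CC R, P s0 t0 = p by eexists.
  (* A local Lipschitz constant of P: the size of its differential plus the error 1 in
     [polar_diff]. *)
  pose q := modc p * modc (ofR l) + modc p * modc v + 1.
  have q0 : 0 < q by rewrite ltr_wpDl // addr_ge0 // mulr_ge0 // modc_ge0.
  have q2 : 0 < 2 * q by rewrite mulr_gt0.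
  have lipP : exists2 d, 0 < d & forall s t, `|s - s0| < d -> `|t - t0| < d ->
      modc (P s t - p) <= q * (`|s - s0| + `|t - t0|).
    have [d d0 Hd] := polar_diff (ln r1) l s0 t0 ltr01; rewrite Ev -/P Ep in Hd.
    exists d => // s t sd td; have {}Hd := Hd s t sd td.
    rewrite -[P s t - p](subrK
      (p * (ofR (s - s0) * ofR l + ofR (t - t0) * v))).
    apply: le_trans (modcD _ _) _; apply: le_trans (lerD Hd (lexx _)) _.
    rewrite [p * _]mulrDr; apply: le_trans (lerD (lexx _) (modcD _ _)) _.
    rewrite !modcM !modc_ofR /q modc_ofR.
    set a := `|s - s0|; set b := `|t - t0|.
    have a0 : 0 <= a by exact: normr_ge0.
    have b0 : 0 <= b by exact: normr_ge0.
    have := modc_ge0 p; have := modc_ge0 v; have := normr_ge0 l.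
    move: (modc p) (modc v) `|l| => x y w w0 y0 x0.
    have : 0 <= x * w * b + x * y * a by rewrite addr_ge0 // !mulr_ge0.
    lra.
  case: (eqVneq p z) => [pz|pz]; last first.
    left; have [|a Ha] := diff_eps (df p pz _).
      rewrite -Ep polar_modc -[X in X <= _ <= _](lnK r10).
      rewrite -[X in _ <= _ <= X](lnK r20) !ler_expR.
      have E : ln r2 = ln r1 + l by rewrite addrC subrK.
      by rewrite E; apply/andP; split; nra.
    (* Chain rule: f has derivative a at p, and P has differential p (l ds + v dt). *)
    exists (a * p) => e' e'0; pose m := modc a + 1.
    have am : modc a <= m by rewrite lerDl.
    have m0 : 0 < m by apply: lt_le_trans (ltr_wpDl (modc_ge0 a) ltr01) _.
    have m2 : 0 < 2 * m by rewrite mulr_gt0.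
    have [|d1 d10 H1] := polar_diff (ln r1) l s0 t0 (e := e' / (2 * m)).
      exact: divr_gt0.
    rewrite Ev -/P Ep in H1; have [d2 d20 H2] := lipP.
    have [|d3 d30 H3] := Ha (e' / (2 * q)); first exact: divr_gt0.
    exists (Num.min (Num.min d1 d2) (d3 / (2 * q))).
      by rewrite !lt_min d10 d20 divr_gt0.
    move=> s t; rewrite !lt_min -!andbA => /and3P[/H1 {}H1 /H2 {}H2 sd].
    move=> /and3P[/H1 {}H1 /H2 {}H2 td].
    have Pd : modc (P s t - p) < d3.
      apply: le_lt_trans H2 _; rewrite mulrC -ltr_pdivlMr //.
      have -> : d3 / q = d3 / (2 * q) + d3 / (2 * q) by field; rewrite gt_eqF.
      exact: ltrD.
    have {}H3 := H3 _ Pd.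
    rewrite /phi Ep.
    have -> : f (P s t) - f p - a * p * (ofR (s - s0) * ofR l + ofR (t - t0) * v)
      = (f (P s t) - f p - a * (P s t - p)) +
        a * (P s t - p - p * (ofR (s - s0) * ofR l + ofR (t - t0) * v)) by ring.
    apply: le_trans (modcD _ _) _; rewrite modcM.
    have T1 : modc (f (P s t) - f p - a * (P s t - p)) <=
        e' / 2 * (`|s - s0| + `|t - t0|).
      apply: le_trans H3 _.
      apply: le_trans (_ : e' / (2 * q) * (q * (`|s - s0| + `|t - t0|)) <= _).
        by apply: ler_wpM2l; [apply/ltW/divr_gt0 | exact: H2].
      by rewrite mulrA; apply: ler_wpM2r; rewrite ?addr_ge0 //;
        have -> : e' / (2 * q) * q = e' / 2 by field; rewrite gt_eqF.
    have T2 : modc a * modc (P s t - p - p * (ofR (s - s0) * ofR l + ofR (t - t0) * v))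
        <= e' / 2 * (`|s - s0| + `|t - t0|).
      apply: le_trans (_ : m * (e' / (2 * m) * (`|s - s0| + `|t - t0|)) <= _).
        by apply: ler_pM; rewrite ?modc_ge0.
      by rewrite mulrA; apply: ler_wpM2r; rewrite ?addr_ge0 //;
        have -> : m * (e' / (2 * m)) = e' / 2 by field; rewrite gt_eqF.
    have -> : e' * (`|s - s0| + `|t - t0|) = e' / 2 * (`|s - s0| + `|t - t0|)
      + e' / 2 * (`|s - s0| + `|t - t0|) by field.
    exact: lerD.
  right; split; last by apply: HAB => //; rewrite Ep.
  move=> e' e'0; have [d1 d10 H1] := cf e' e'0; have [d2 d20 H2] := lipP.
  exists (Num.min d2 (d1 / (2 * q))).
    by rewrite lt_min d20 divr_gt0.
  move=> s t; rewrite !lt_min => /andP[/H2 {}H2 sd] /andP[/H2 {}H2 td].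
  rewrite /phi Ep pz; apply: H1; rewrite -pz; apply: le_lt_trans H2 _.
  rewrite mulrC -ltr_pdivlMr //.
  have -> : d1 / q = d1 / (2 * q) + d1 / (2 * q) by field; rewrite gt_eqF.
  exact: ltrD.
have [N0 HN] := discrete_Goursat incA incB reg e0.
exists N0 => N N0N; apply: le_trans (HN N N0N).
have -> : bdry phi (ofR l) v N 0 0 1 = v * (mean N f r2 - mean N f r1).
  have E x : phi x (0 + 1) = phi x 0 by rewrite add0r /phi /P /polar turn1 turn0.
  rewrite /bdry add0r.
  have -> : (fun x => phi x 1) = (fun x => phi x 0).
    by apply/funext => x; rewrite -[1]add0r E.
  rewrite subrr add0r -mulrBr; congr (v * (_ - _)); rewrite /mean /riemann mulr_suml;
  by apply: eq_bigr => j _; rewrite /phi add0r ?P0 ?P1 !div1r.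
(* The factor v = 2 pi i has modulus at least 1, so removing it does not weaken the bound. *)
rewrite modcM ler_peMl ?modc_ge0 //.
rewrite -Ev modcM modc_ofR.
have -> : modc 'i = 1 :> R by apply: ofR_inj; rewrite -modcE normCi ofR1.
by have pi2 := @pi_ge2 R; rewrite mul1r ger0_norm; lra.
Qed.

End CircleMeans.

(** * Roots of unity *)

Lemma near_eq_differentiable (K : numFieldType) (V W : normedModType K)
    (f g : V -> W) (x : V) :
  (\forall y \near x, f y = g y) -> differentiable f x -> differentiable g x.
Proof.
move=> fg df; apply/diffP.
(* The differential of g is a chosen linear map, so a map with the required properties has to be
   exhibited; the differential of f serves. *)
apply: (@getPex _ (fun (dg : {linear V -> W}) => continuous dg /\
  forall y, g y = g (lim (nbhs x)) + dg (y - lim (nbhs x))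
                  +o_(y \near x) (y - lim (nbhs x)))).
exists ('d f x); split; first exact: diff_continuous.
suff Hg : g = cst (g (lim (nbhs x))) + 'd f x \o center (lim (nbhs x))
     +o_ x (center (lim (nbhs x))) by move=> y; rewrite {1}Hg.
apply/eqaddoP => e e0.
case: (df) => -[_ /eqaddoP /(_ e e0) H].
rewrite lim_id // in H *.
have fgx := nbhs_singleton fg.
near=> z.
have -> : (g - (cst (g x) + 'd f x \o center x)) z =
   (f - (cst (f x) + 'd f x \o center x)) z.
  by rewrite !fctE fgx; congr (_ - _); near: z; apply: filterS fg => ? ->.
by near: z.
Unshelve. all: by end_near. Qed.

Section RootsOfUnity.
Context {R : realType} (M : nat) (w r : CC R).
Hypotheses (M0 : (0 < M)%N) (wP : M.-primitive_root w) (r0 : r != 0).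

Definition avg (F : CC R -> CC R) : CC R := (\sum_(j < M) F (r * w ^+ j)) / M%:R.

Lemma M_neq0 : (M%:R : CC R) != 0. Proof. by rewrite pnatr_eq0 -lt0n. Qed.

Lemma node_neq0 (j : 'I_M) : r * w ^+ j != 0.
Proof.
rewrite mulf_neq0 // expf_neq0 //; apply/eqP => w0.
by have := prim_expr_order wP; rewrite w0 expr0n gtn_eqF // => /eqP;
  rewrite eq_sym oner_eq0.
Qed.

Lemma node_expM (j : 'I_M) : (r * w ^+ j) ^+ M = r ^+ M.
Proof. by rewrite exprMn exprAC (prim_expr_order wP) expr1n mulr1. Qed.

Lemma node_exprV (j : 'I_M) m : (m <= M)%N ->
  (r * w ^+ j) ^- m = (r * w ^+ j) ^+ (M - m) / r ^+ M.
Proof.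
move=> mM; have l0 := node_neq0 j; rewrite -(node_expM j).
set l := r * _; apply: (mulfI (expf_neq0 m l0)).
by rewrite divff ?expf_neq0 // mulrA -exprD subnKC // divff // expf_neq0.
Qed.

Lemma eq_avg F G : (forall j : 'I_M, F (r * w ^+ j) = G (r * w ^+ j)) ->
  avg F = avg G.
Proof. by move=> FG; congr (_ / _); apply: eq_bigr => j _. Qed.

Lemma avg_sum (I : Type) (s : seq I) (P : pred I) (F : I -> CC R -> CC R) :
  avg (fun l => \sum_(i <- s | P i) F i l) = \sum_(i <- s | P i) avg (F i).
Proof. by rewrite /avg exchange_big /= mulr_suml. Qed.

Lemma avgZ a F : avg (fun l => a * F l) = a * avg F.
Proof. by rewrite /avg -mulr_sumr mulrA. Qed.

Lemma avg_expr a : avg (fun l => l ^+ a) = (M %| a)%:R * r ^+ a.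
Proof.
rewrite /avg; under eq_bigr do rewrite exprMn exprAC.
rewrite -mulr_sumr; have [Ma|Ma] := boolP (M %| a)%N.
  have -> : w ^+ a = 1 by apply/eqP; rewrite -(prim_order_dvd wP).
  under eq_bigr do rewrite expr1n.
  by rewrite sumr_const card_ord mulfK ?mul1r // M_neq0.
rewrite mul0r; apply/eqP; rewrite mulf_eq0 mulf_eq0; apply/orP; left; apply/orP; right.
have wa : w ^+ a - 1 != 0 by rewrite subr_eq0 -(prim_order_dvd wP).
rewrite -(mulrI_eq0 _ (mulfI wa)) -subrX1 exprAC (prim_expr_order wP).
by rewrite expr1n subrr.
Qed.

Lemma avg_exprV m : (0 < m < M)%N -> avg (fun l => l ^- m) = 0.
Proof.
move=> /andP[m0 mM].
transitivity (r ^- M * avg (fun l => l ^+ (M - m))).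
  rewrite -avgZ; apply: eq_avg => j.
  by rewrite node_exprV 1?mulrC // ltnW.
rewrite avg_expr gtnNdvd ?mul0r ?mulr0 //; lia.
Qed.

(** At a node l^M = r^M, so z / (z - l) is the finite geometric sum of the z^(M - k) l^k over z^M -
    r^M. Averaging against l^-m leaves only k = m. *)
Lemma avg_kernel z m : (m < M)%N -> z ^+ M != r ^+ M ->
  avg (fun l => z / (z - l) * l ^- m) = z ^+ (M - m) / (z ^+ M - r ^+ M).
Proof.
move=> mM zr; have zr' : z ^+ M - r ^+ M != 0 by rewrite subr_eq0.
transitivity (\sum_(k < M) z ^+ (M - k) / (z ^+ M - r ^+ M) * r ^- M *
   avg (fun l => l ^+ (M + k - m))); last first.
  rewrite (bigD1 (Ordinal mM)) //= big1 ?addr0; last first.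
    move=> k km; rewrite avg_expr.
    suff /negPf -> : ~~ (M %| M + k - m)%N by rewrite mul0r mulr0.
    apply/negP => /dvdnP[q Eq]; have kM := ltn_ord k.
    have km' : (k : nat) != m by apply: contra km => /eqP H; apply/eqP/val_inj.
    by case: q Eq => [|[|q]] Eq; nia.
  rewrite avg_expr addnK dvdnn mul1r divfK //.
  by rewrite expf_neq0.
under [RHS]eq_bigr do rewrite -avgZ.
rewrite -avg_sum; apply: eq_avg => j.
set l := r * w ^+ j; have lM : l ^+ M = r ^+ M := node_expM j.
have l0 : l != 0 := node_neq0 j.
have zl : z - l != 0.
  by apply: contra zr; rewrite subr_eq0 => /eqP ->; rewrite lM.
have -> : z / (z - l) = \sum_(k < M) z ^+ (M - k) * l ^+ k / (z ^+ M - r ^+ M).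
  rewrite -mulr_suml; apply: (mulIf zr'); rewrite divfK // -lM subrXX.
  rewrite mulrA divfK // mulr_sumr; apply: eq_bigr => k _.
  rewrite mulrA -exprS; congr (_ ^+ _ * _); have := ltn_ord k; lia.
rewrite mulr_suml; apply: eq_bigr => k _.
have -> : l ^- m = l ^+ (M - m) / r ^+ M.
  by rewrite node_exprV // ltnW.
have -> : l ^+ (M + k - m) = l ^+ k * l ^+ (M - m).
  by rewrite -exprD; congr (_ ^+ _); lia.
by ring.
Qed.

End RootsOfUnity.

(** * Cauchy's formula *)

Section Differentiability.
Context {K : numFieldType} {V : normedModType K}.
Implicit Types (f g : V -> K) (x : V).

Lemma diff_add f g x : differentiable f x -> differentiable g x ->
  differentiable (fun y => f y + g y) x.
Proof. exact: differentiableD. Qed.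

Lemma diff_sub f g x : differentiable f x -> differentiable g x ->
  differentiable (fun y => f y - g y) x.
Proof. exact: differentiableB. Qed.

Lemma diff_mul f g x : differentiable f x -> differentiable g x ->
  differentiable (fun y => f y * g y) x.
Proof. exact: differentiableM. Qed.

Lemma diff_inv f x : f x != 0 -> differentiable f x ->
  differentiable (fun y => (f y)^-1) x.
Proof. by move=> fx df; exact: differentiableV. Qed.

Lemma diff_cst (a : K) x : differentiable (fun _ : V => a) x.
Proof. exact: differentiable_cst. Qed.

Lemma diff_exp f n x : differentiable f x -> differentiable (fun y => f y ^+ n) x.
Proof.
move=> df; elim: n => [|n IH]; first exact: diff_cst.
by under eq_fun => y do rewrite exprS; exact: diff_mul.
Qed.

Lemma diff_bigsum (I : Type) (s : seq I) (P : pred I) (F : I -> V -> K) x :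
  (forall i, P i -> differentiable (F i) x) ->
  differentiable (fun y => \sum_(i <- s | P i) F i y) x.
Proof.
move=> dF; elim: s => [|i s IH].
  rewrite (_ : (fun y => _) = fun=> 0); first exact: diff_cst.
  by apply/funext => y; rewrite big_nil.
rewrite (_ : (fun y => _) = fun y => if P i then F i y + \sum_(j <- s | P j) F j y
  else \sum_(j <- s | P j) F j y); last by apply/funext => y; rewrite big_cons.
by case: (boolP (P i)) => // Pi; apply: diff_add => //; exact: dF.
Qed.

Lemma diff_bigprod (I : Type) (s : seq I) (P : pred I) (F : I -> V -> K) x :
  (forall i, P i -> differentiable (F i) x) ->
  differentiable (fun y => \prod_(i <- s | P i) F i y) x.
Proof.
move=> dF; elim: s => [|i s IH].
  rewrite (_ : (fun y => _) = fun=> 1); first exact: diff_cst.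
  by apply/funext => y; rewrite big_nil.
rewrite (_ : (fun y => _) = fun y => if P i then F i y * \prod_(j <- s | P j) F j y
  else \prod_(j <- s | P j) F j y); last by apply/funext => y; rewrite big_cons.
by case: (boolP (P i)) => // Pi; apply: diff_mul => //; exact: dF.
Qed.

End Differentiability.

Section CauchyFormula.
Context {R : realType}.
Implicit Types (e d r S : R) (z : CC R) (f : CC R -> CC R).

Lemma diff_id z : differentiable (fun w : CC R => w) z.
Proof. exact: ex_diff. Qed.

Lemma diff_continuous_eps f z e : differentiable f z -> 0 < e ->
  exists2 d, 0 < d & forall w, modc (w - z) < d -> modc (f w - f z) <= e.
Proof.
move=> /diff_eps[a Ha] e0; have [d d0 Hd] := Ha 1 ltr01.
have a1 : 0 < modc a + 1 by have := modc_ge0 a; lra.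
exists (Num.min d (e / (modc a + 1))); first by rewrite lt_min d0 divr_gt0.
move=> w; rewrite lt_min => /andP[/Hd {}Hd we].
rewrite -[f w - f z](subrK (a * (w - z))); apply: le_trans (modcD _ _) _.
rewrite modcM; apply: le_trans (lerD Hd (lexx _)) _.
by rewrite -mulrDl addrC mulrC -ler_pdivlMr // ltW.
Qed.

Lemma prim_node N : (2 ^ N).-primitive_root (turn (2 ^ N)%N%:R^-1 : CC R).
Proof. by apply: turn_prim; rewrite expn_gt0. Qed.

Lemma mean_avg N f r :
  mean N f r = avg (2 ^ N) (turn (2 ^ N)%N%:R^-1) (ofR r) f.
Proof.
rewrite /mean /avg big_mkord ofRV ofRX ofR_nat -!natrX; congr (_ / _).
by apply: eq_bigr => j _; rewrite turnX.
Qed.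

Lemma mean_bound N f r K :
  (forall w, modc w = r -> modc (f w) <= K) -> 0 <= r ->
  modc (mean N f r) <= K.
Proof.
move=> fK r0; have E2 : (0 : R) < 2 ^+ N by rewrite exprn_gt0.
rewrite /mean modcM modc_ofR gtr0_norm ?invr_gt0 // ler_pdivrMr //.
apply: le_trans (modc_sum _ _ _) _.
have -> : K * 2 ^+ N = \sum_(0 <= j < 2 ^ N) K.
  by rewrite sumr_const_nat subn0 -natrX mulr_natr.
apply: ler_sum => j _; apply: fK.
by rewrite modcM modc_turn mulr1 modc_ofR ger0_norm.
Qed.

Lemma geometric_small (a b : CC R) e : modc a < modc b -> 0 < e ->
  exists N0, forall N, (N0 <= N)%N ->
    modc (a ^+ (2 ^ N) / (b ^+ (2 ^ N) - a ^+ (2 ^ N))) <= e.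
Proof.
move=> ab e0; have b0 : 0 < modc b := le_lt_trans (modc_ge0 a) ab.
set q := modc a / modc b.
have q0 : 0 <= q by rewrite divr_ge0 // ?modc_ge0 // ltW.
have q1 : q < 1 by rewrite ltr_pdivrMr // mul1r.
(* The bound 1/2 on q^M keeps the denominator at least half of |b|^M; the bound e/2 then makes the
   quotient at most e. *)
have c0 : 0 < Num.min (1 / 2) (e / 2) by rewrite lt_min !divr_gt0.
have /cvgrPdist_lt /(_ _ c0) [N0 _ HN] : q ^+ n @[n --> \oo] --> 0.
  by apply: cvg_expr; rewrite ger0_norm.
exists N0 => N NN; set M := (2 ^ N)%N.
have : q ^+ M < Num.min (1 / 2) (e / 2).
  have := HN M; rewrite /= sub0r normrN ger0_norm ?exprn_ge0 //; apply.
  by apply: leq_trans NN _; apply: ltnW; exact: ltn_expl.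
rewrite lt_min => /andP[qh qe].
have bM : 0 < modc b ^+ M by rewrite exprn_gt0.
have aq : modc a ^+ M = q ^+ M * modc b ^+ M.
  by rewrite -exprMn divfK // gt_eqF.
rewrite modcM modcV modcX.
have den : modc b ^+ M / 2 <= modc (b ^+ M - a ^+ M).
  by apply: le_trans (modc_distl _ _); rewrite !modcX aq; nra.
rewrite ler_pdivrMr; last by apply: lt_le_trans den; lra.
apply: le_trans (_ : e * (modc b ^+ M / 2) <= _); last first.
  by apply: ler_wpM2l => //; lra.
by rewrite aq; nra.
Qed.

(** A discrete residue: the value tends to 1 for |z| < r and to 0 for |z| > r. It comes from l / (l
    - z) = 1 - z / (z - l) and [avg_kernel] with m = 0. *)
Lemma mean_kernel N z r : 0 < r -> modc z != r ->
  mean N (fun l => l / (l - z)) r =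
    ofR r ^+ (2 ^ N) / (ofR r ^+ (2 ^ N) - z ^+ (2 ^ N)).
Proof.
move=> r0 zr; rewrite mean_avg; set M := (2 ^ N)%N.
have M0 : (0 < M)%N by rewrite expn_gt0.
have zM : z ^+ M != ofR r ^+ M.
  apply: contra zr => /eqP /(congr1 modc); rewrite !modcX modc_ofR gtr0_norm //.
  by move/eqP; rewrite eqrXn2 // ?modc_ge0 // ltW.
have r0' : ofR r != 0 by rewrite -modc_gt0 modc_ofR normr_gt0 gt_eqF.
have H : avg M (turn M%:R^-1) (ofR r) (fun l => 1 - z / (z - l) * l ^- 0) =
    ofR r ^+ M / (ofR r ^+ M - z ^+ M).
  have zM' : z ^+ M - ofR r ^+ M != 0 by rewrite subr_eq0.
  have zM2 : ofR r ^+ M - z ^+ M != 0 by rewrite -oppr_eq0 opprB.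
  have -> : avg M (turn M%:R^-1) (ofR r) (fun l => 1 - z / (z - l) * l ^- 0) =
      1 - avg M (turn M%:R^-1) (ofR r) (fun l => z / (z - l) * l ^- 0).
    rewrite /avg sumrB mulrBl sumr_const card_ord divff //.
    by rewrite pnatr_eq0 -lt0n.
  rewrite (avg_kernel M0 (prim_node N)) // subn0; field.
  by rewrite zM' zM2.
rewrite -H; apply: eq_avg => j; set l := ofR r * turn _ ^+ _.
have lM : l ^+ M = ofR r ^+ M by exact: (@node_expM R M (turn M%:R^-1) (ofR r) (prim_node N) j).
have zl : z - l != 0 by rewrite subr_eq0; apply: contra zM => /eqP ->; rewrite lM.
have lz : l - z != 0 by rewrite -oppr_eq0 opprB.
by rewrite expr0 invr1 mulr1; field; rewrite zl lz.
Qed.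

Lemma eventually_all (I : eqType) (s : seq I) (P : I -> nat -> Prop) :
  (forall i, i \in s -> exists N0, forall N, (N0 <= N)%N -> P i N) ->
  exists N, forall i, i \in s -> P i N.
Proof.
move=> H; suff [N0 HN0] : exists N0, forall i, i \in s ->
    forall N, (N0 <= N)%N -> P i N by exists N0 => i /HN0; apply.
elim: s H => [|i s IH] H; first by exists 0%N.
have [N1 H1] := H i (mem_head _ _).
have [|N2 H2] := IH.
  by move=> j js; apply: H; rewrite inE js orbT.
exists (maxn N1 N2) => j; rewrite inE => /predU1P[->|js] N; rewrite geq_max => /andP[??].
  exact: H1.
exact: H2.
Qed.

(** [circle_means_limit] is applied to q(w) = (f w - f z) w / (w - z), extended continuously by
    [a * z] at its exceptional point z. Splitting off the part with f z leaves the means of l / (l -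
    z), known exactly by [mean_kernel]. *)
Lemma cauchy_limit f z r1 r2 e : 0 < r1 -> r1 < modc z < r2 ->
  (forall w, r1 <= modc w <= r2 -> differentiable f w) -> 0 < e ->
  exists N0, forall N, (N0 <= N)%N ->
    modc (f z - (mean N (fun l => f l * (l / (l - z))) r2
                 - mean N (fun l => f l * (l / (l - z))) r1)) <= e.
Proof.
move=> r10 /andP[rz zr] df e0.
have z0 : z != 0 by rewrite -modc_gt0; lra.
have [|a Ha] := diff_eps (df z _); first lra.
pose q w := if w == z then a * z else (f w - f z) * (w / (w - z)).
have dq w : w != z -> r1 <= modc w <= r2 -> differentiable q w.
  move=> wz wr; apply: (@near_eq_differentiable _ _ _
    (fun w => (f w - f z) * (w / (w - z)))).
    have : \forall y \near w, y != z.
      apply/nbhs_normP; exists `|w - z|; first by rewrite /= normr_gt0 subr_eq0.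
      by move=> y /= yw; apply/eqP => yz; rewrite yz ltxx in yw.
    by apply: filterS => y /negPf yz; rewrite /q yz.
  apply: diff_mul; first by apply: diff_sub; [exact: df|exact: diff_cst].
  apply: diff_mul; first exact: diff_id.
  apply: diff_inv; first by rewrite subr_eq0.
  by apply: diff_sub; [exact: diff_id|exact: diff_cst].
have cq e' : 0 < e' -> exists2 d, 0 < d &
    forall w, modc (w - z) < d -> modc (q w - q z) <= e'.
  move=> e'0; pose b := modc z + 1.
  have b0 : 0 < b by have := modc_ge0 z; rewrite /b; lra.
  have [|d d0 Hd] := Ha (e' / (2 * b)); first by rewrite divr_gt0 //; lra.
  have a1 : 0 < 2 * (modc a + 1) by have := modc_ge0 a; lra.
  exists (Num.min d (Num.min 1 (e' / (2 * (modc a + 1))))).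
    by rewrite !lt_min d0 ltr01 divr_gt0.
  move=> w; rewrite !lt_min => /and3P[/Hd {}Hd w1 wa].
  rewrite /q eqxx; case: (eqVneq w z) => [_|wz]; first by rewrite subrr modc0 ltW.
  have wz' : w - z != 0 by rewrite subr_eq0.
  have -> : (f w - f z) * (w / (w - z)) - a * z =
    (f w - f z - a * (w - z)) / (w - z) * w + a * (w - z) by field.
  apply: le_trans (modcD _ _) _; rewrite !modcM modcV.
  have wzp : 0 < modc (w - z) by rewrite modc_gt0.
  have H1 : modc (f w - f z - a * (w - z)) / modc (w - z) <= e' / (2 * b).
    by rewrite ler_pdivrMr.
  have H2 : modc w <= b.
    by rewrite -[w](subrK z); apply: le_trans (modcD _ _) _; rewrite /b; lra.
  have H3 : modc (f w - f z - a * (w - z)) / modc (w - z) * modc w <= e' / 2.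
    apply: le_trans (_ : e' / (2 * b) * b <= _); last first.
      by rewrite invfM mulrA divfK // gt_eqF.
    by apply: ler_pM; rewrite ?divr_ge0 ?modc_ge0.
  have H4 : modc a * modc (w - z) <= e' / 2.
    apply: le_trans (_ : (modc a + 1) * (e' / (2 * (modc a + 1))) <= _).
      by apply: ler_pM; rewrite ?modc_ge0 ?ltW //; lra.
    have ha : modc a + 1 != 0 by rewrite gt_eqF //; lra.
    by rewrite le_eqVlt; apply/orP; left; apply/eqP; field.
  lra.
have e2 : 0 < e / 2 by lra.
have [|N1 H1] := circle_means_limit _ dq cq e2; first lra.
pose g := modc (f z) + 1.
have g0 : 0 < g by have := modc_ge0 (f z); rewrite /g; lra.
have e4 : 0 < e / (4 * g) by rewrite divr_gt0 //; lra.
have r20 : 0 < r2 by lra.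
have mo r : 0 < r -> modc (ofR r) = r by move=> r0; rewrite modc_ofR gtr0_norm.
have [|N2 H2] := geometric_small (a := z) (b := ofR r2) _ e4.
  by rewrite mo //; lra.
have [|N3 H3] := geometric_small (a := ofR r1) (b := z) _ e4.
  by rewrite mo //; lra.
exists (maxn N1 (maxn N2 N3)) => N; rewrite !geq_max => /and3P[/H1 {}H1 /H2 {}H2 /H3 {}H3].
have Eq r : 0 < r -> modc z != r -> mean N q r =
    mean N (fun l => f l * (l / (l - z))) r - f z * mean N (fun l => l / (l - z)) r.
  move=> r0 zr'; rewrite /mean mulrA -mulrBl mulr_sumr -sumrB.
  congr (_ * _); apply: eq_bigr => j _.
  rewrite /q ifN; first by ring.
  by apply: contra zr' => /eqP <-; rewrite modcM modc_turn mulr1 mo.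
have n1 : modc z != r1 by rewrite gt_eqF.
have n2 : modc z != r2 by rewrite lt_eqF.
move: H1; rewrite !Eq // !mean_kernel //.
set A := mean _ _ r2; set B := mean _ _ r1; set M := (2 ^ N)%N in H2 H3 *.
have d1 : z ^+ M - ofR r1 ^+ M != 0.
  rewrite subr_eq0; apply: contra n1 => /eqP /(congr1 modc); rewrite !modcX mo //.
  by move/eqP; rewrite eqrXn2 // ?modc_ge0 ?expn_gt0 // ltW.
have d2 : ofR r2 ^+ M - z ^+ M != 0.
  rewrite subr_eq0 eq_sym; apply: contra n2 => /eqP /(congr1 modc); rewrite !modcX mo //.
  by move/eqP; rewrite eqrXn2 // ?modc_ge0 ?expn_gt0 // ltW.
have d3 : ofR r1 ^+ M - z ^+ M != 0 by rewrite subr_eq0 eq_sym -subr_eq0.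
move=> H1.
(* With x, y, w the M-th powers of z, r1, r2: the outer kernel mean is 1 + x / (w - x) and the inner
   one is - y / (x - y). Both corrections are small by [geometric_small]. *)
have E (x y w : CC R) : x - y != 0 -> w - x != 0 -> y - x != 0 ->
  f z - (A - B) = - (A - f z * (w / (w - x)) - (B - f z * (y / (y - x))))
    - f z * (x / (w - x)) - f z * (y / (x - y)).
  by move=> h1 h2 h3; field; rewrite h1 h2 h3.
rewrite (E _ _ _ d1 d2 d3).
apply: le_trans (modcB _ _) _; apply: le_trans (lerD (modcB _ _) (lexx _)) _.
rewrite modcN (modcM (f z) (_ / (ofR r2 ^+ M - _))) (modcM (f z) (_ / (_ - ofR r1 ^+ M))).
have fg : modc (f z) <= g by rewrite lerDl.
have B1 x : 0 <= x -> x <= e / (4 * g) -> modc (f z) * x <= e / 4.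
  move=> x0 xe; apply: le_trans (ler_pM (modc_ge0 _) x0 fg xe) _.
  by rewrite le_eqVlt; apply/orP; left; apply/eqP; field; rewrite gt_eqF.
have -> : e = e / 2 + e / 4 + e / 4 by field.
apply: lerD; first apply: lerD; first exact: H1.
- exact: B1 (modc_ge0 _) H2.
- exact: B1 (modc_ge0 _) H3.
Qed.

(** The list holds pairs (weight, point). By Cauchy's formula the weighted sum of values of f is, up
    to any e, a difference of means of f times the weighted sum of kernels; bounds for the kernels
    on the two circles therefore suffice. *)
Lemma cauchy_dual f (s : seq (CC R * CC R)) r1 r2 S (K1 K2 : R) : 0 < r1 ->
  (forall w, r1 <= modc w <= r2 -> differentiable f w) ->
  (forall p, p \in s -> r1 < modc p.2 < r2) ->
  (forall w, modc w = r1 \/ modc w = r2 -> modc (f w) <= S) ->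
  (forall w, modc w = r1 ->
     modc (\sum_(p <- s) p.1 * (w / (w - p.2))) <= K1) ->
  (forall w, modc w = r2 ->
     modc (\sum_(p <- s) p.1 * (w / (w - p.2))) <= K2) ->
  0 < r2 ->
  modc (\sum_(p <- s) p.1 * f p.2) <= S * (K1 + K2).
Proof.
move=> r10 df sr fS k1 k2 r20; apply/ler_addgt0Pl => e e0.
pose c := \sum_(p <- s) modc p.1 + 1.
have c0 : 0 < c by rewrite ltr_wpDl // sumr_ge0 // => i _; exact: modc_ge0.
pose F (p : CC R * CC R) l := f l * (l / (l - p.2)).
have [N HN] : exists N, forall p, p \in s ->
    modc (f p.2 - (mean N (F p) r2 - mean N (F p) r1)) <= e / c.
  apply: eventually_all => p ps; apply: cauchy_limit => //; first exact: sr.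
  by rewrite divr_gt0.
have -> : \sum_(p <- s) p.1 * f p.2 =
    \sum_(p <- s) p.1 * (f p.2 - (mean N (F p) r2 - mean N (F p) r1))
    + (mean N (fun l => f l * \sum_(p <- s) p.1 * (l / (l - p.2))) r2
     - mean N (fun l => f l * \sum_(p <- s) p.1 * (l / (l - p.2))) r1).
  have E r : mean N (fun l => f l * \sum_(p <- s) p.1 * (l / (l - p.2))) r
      = \sum_(p <- s) p.1 * mean N (F p) r.
    rewrite /mean; under eq_bigr do rewrite mulr_sumr.
    rewrite exchange_big /= mulr_suml; apply: eq_bigr => p _.
    by rewrite mulrA mulr_sumr; congr (_ * _); apply: eq_bigr => j _; rewrite /F; ring.
  rewrite !E -sumrB -big_split /=; apply: eq_bigr => p _; ring.
apply: le_trans (modcD _ _) _; apply: lerD.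
  apply: le_trans (modc_sum _ _ _) _.
  apply: le_trans (_ : (\sum_(p <- s) modc p.1) * (e / c) <= _).
    rewrite mulr_suml big_seq [leRHS]big_seq; apply: ler_sum => p ps.
    by rewrite modcM; apply: ler_wpM2l; [exact: modc_ge0|exact: HN].
  by rewrite mulrCA ler_piMr ?ltW // ltr_pdivrMr // mul1r /c; lra.
apply: le_trans (modcB _ _) _; rewrite addrC mulrDr; apply: lerD.
- apply: mean_bound; last exact: ltW.
  move=> w wr; rewrite modcM; apply: ler_pM; rewrite ?modc_ge0 //; last exact: k1.
  by apply: fS; left.
- apply: mean_bound; last exact: ltW.
  move=> w wr; rewrite modcM; apply: ler_pM; rewrite ?modc_ge0 //; last exact: k2.
  by apply: fS; right.
Qed.

End CauchyFormula.

(** * Interpolation at roots of unity *)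

Section Kernels.
Context {R : realType} (M : nat) (w r : CC R).
Hypotheses (M0 : (0 < M)%N) (wP : M.-primitive_root w) (r0 : r != 0).
Implicit Types z l u v : CC R.

(** For a node l, [geom (z / l)] divided by M is the Lagrange basis polynomial in z: it is 1 at l
    and 0 at the other nodes. *)
Definition geom z : CC R := \sum_(m < M) z ^+ m.

Lemma geom_avgE (F : CC R -> CC R) z :
  avg M w r (fun l => F l * geom (z / l)) =
  \sum_(m < M) z ^+ m * avg M w r (fun l => F l * l ^- m).
Proof.
under [RHS]eq_bigr do rewrite -avgZ.
rewrite -avg_sum; apply: eq_avg => j; rewrite mulr_sumr.
by apply: eq_bigr => m _; rewrite exprMn exprVn; ring.
Qed.

(** The left side interpolates the kernel u / (u - l) as a polynomial in z. On the right the last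
    factor is 1 exactly when z^M = r^M, that is, at the nodes. *)
Lemma kernel_out u z : u ^+ M != r ^+ M -> u != z ->
  avg M w r (fun l => u / (u - l) * geom (z / l)) =
  u / (u - z) * ((u ^+ M - z ^+ M) / (u ^+ M - r ^+ M)).
Proof.
move=> ur uz; have uz' : u - z != 0 by rewrite subr_eq0.
have -> : avg M w r (fun l => u / (u - l) * geom (z / l)) =
    \sum_(m < M) z ^+ m * (u ^+ (M - m) / (u ^+ M - r ^+ M)).
  by rewrite geom_avgE; apply: eq_bigr => m _; rewrite avg_kernel.
rewrite (subrXX u z) [RHS]mulrA [u / _ * _]mulrA divfK //.
rewrite [u * _]mulr_sumr mulr_suml; apply: eq_bigr => m _; rewrite mulrA; congr (_ / _).
rewrite mulrA -exprS mulrC; congr (_ ^+ _ * _); have := ltn_ord m; lia.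
Qed.

(** The counterpart for interpolation without constant term. Since l / (l - v) = 1 - v / (v - l), it
    reduces to [kernel_out] and to [avg_kernel] with m = 0. *)
Lemma kernel_in v y : v ^+ M != r ^+ M -> v != y ->
  avg M w r (fun l => l / (l - v) * (geom (y / l) - 1)) =
  y / (y - v) * ((v ^+ M - v * y ^+ M.-1) / (v ^+ M - r ^+ M)).
Proof.
move=> vr vy; have vy' : v - y != 0 by rewrite subr_eq0.
have yv' : y - v != 0 by rewrite subr_eq0 eq_sym.
have vr' : v ^+ M - r ^+ M != 0 by rewrite subr_eq0.
have A1 : avg M w r (fun l => 1 * geom (y / l)) = 1.
  rewrite geom_avgE (bigD1 (Ordinal M0)) //= big1 ?addr0 => [|m m0].
    rewrite expr0 mul1r.
    transitivity (avg M w r (fun l => l ^+ 0)).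
      by apply: eq_avg => j; rewrite expr0 invr1 mulr1.
    by rewrite avg_expr // dvdn0 mul1r expr0.
  transitivity (y ^+ m * avg M w r (fun l => l ^- m)).
    by congr (_ * _); apply: eq_avg => j; rewrite mul1r.
  rewrite avg_exprV ?mulr0 // ltn_ord andbT lt0n.
  by apply: contra m0 => /eqP m0; apply/eqP/val_inj.
transitivity (avg M w r (fun l => 1 * geom (y / l))
    - avg M w r (fun l => v / (v - l) * geom (y / l))
    - avg M w r (fun l => 1 * l ^- 0) + avg M w r (fun l => v / (v - l) * l ^- 0)).
  rewrite /avg -!mulrBl -mulrDl -!sumrB -big_split /=; congr (_ / _).
  apply: eq_bigr => j _; set l := r * _.
  have lM : l ^+ M = r ^+ M := node_expM r wP j.
  have vl : v - l != 0.
    by apply: contra vr; rewrite subr_eq0 => /eqP ->; rewrite lM.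
  have lv : l - v != 0 by rewrite -oppr_eq0 opprB.
  move: (geom _) => g; rewrite expr0; field; by rewrite vl lv.
rewrite A1 kernel_out // avg_kernel // subn0.
have -> : avg M w r (fun l => 1 * l ^- 0) = 1.
  transitivity (avg M w r (fun l => l ^+ 0)).
    by apply: eq_avg => j; rewrite expr0 invr1 mulr1.
  by rewrite avg_expr // dvdn0 mul1r expr0.
have -> : y ^+ M = y * y ^+ M.-1 by rewrite -exprS prednK.
move: (y ^+ _) => a; move: vr'; move: (v ^+ M) (r ^+ M) => b c h.
by field; rewrite vy' yv' h.
Qed.

End Kernels.

Section Interpolation.
Context {R : realType} (N : nat) (B : R).
Hypothesis B0 : 0 < B.
Implicit Types (S : R) (f : CC R -> CC R) (z l u v y : CC R).

Local Ltac lraB := have := B0; lra.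

Local Notation M := (2 ^ N)%N.
Local Notation rho := (ofR (4 * B) : CC R).

(** The factors 4 (from B to the nodes) and 3 (from the nodes to the Cauchy circle) are chosen so
    that 4^M - 1 and 3^M - 1 are at least 2^M; this bounds the denominators u^M - rho^M from below
    on both sides of the nodes. *)
Definition node (j : 'I_M) : CC R := rho * turn M%:R^-1 ^+ j.

Definition gavg (F : CC R -> CC R) : CC R := (\sum_(j < M) F (node j)) / M%:R.

Lemma M_gt0 : (0 < M)%N. Proof. by rewrite expn_gt0. Qed.

Lemma modc_rho : modc rho = 4 * B.
Proof. by rewrite modc_ofR gtr0_norm //; lraB. Qed.

Lemma rho_neq0 : rho != 0.
Proof. by rewrite -modc_gt0 modc_rho; lraB. Qed.

Lemma modc_node j : modc (node j) = 4 * B.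
Proof. by rewrite modcM modc_rho modcX modc_turn expr1n mulr1. Qed.

Lemma modc_lt_neqX z r : modc z != r -> 0 <= r -> z ^+ M != ofR r ^+ M.
Proof.
move=> zr r0; apply: contra zr => /eqP /(congr1 modc).
rewrite !modcX modc_ofR ger0_norm //; move/eqP.
by rewrite eqrXn2 // ?modc_ge0 // M_gt0.
Qed.

Lemma modc_expB a b (K L : R) : modc a <= K -> modc b <= L ->
  modc (a ^+ M - b ^+ M) <= K ^+ M + L ^+ M.
Proof.
move=> aK bL; apply: le_trans (modcB _ _) _; rewrite !modcX.
by apply: lerD; rewrite lerXn2r // ?nnegrE ?modc_ge0 //;
  [apply: le_trans aK | apply: le_trans bL]; exact: modc_ge0.
Qed.

Lemma den_large a (k : R) : 3 <= k -> modc a = k * (4 * B) ->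
  2 ^+ M * (4 * B) ^+ M <= modc (a ^+ M - rho ^+ M).
Proof.
move=> k3 ak; apply: le_trans (modc_distl _ _); rewrite !modcX ak modc_rho.
rewrite [(k * _) ^+ _]exprMn -[X in _ <= _ - X]mul1r -mulrBl; apply: ler_wpM2r.
  by rewrite exprn_ge0 //; lraB.
rewrite lerBrDr; apply: le_trans (_ : (2 + 1) ^+ M <= _); last first.
  by rewrite lerXn2r // ?nnegrE; lraB.
rewrite -[X in _ + X](expr1n R M); elim: (M) M_gt0 => // -[|m] IH _.
  by rewrite !expr1.
rewrite exprS [X in _ + X]exprS [leRHS]exprS.
have := IH isT; have : 0 <= 2 ^+ m.+1 :> R by rewrite exprn_ge0.
have : 0 <= 1 ^+ m.+1 :> R by rewrite exprn_ge0.
move: (2 ^+ _) (1 ^+ _) ((2 + 1) ^+ _) => x y' z'; lraB.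
Qed.

Lemma den_small a : modc a <= B ->
  2 ^+ M * B ^+ M <= modc (a ^+ M - rho ^+ M).
Proof.
move=> aB; rewrite modc_subC; apply: le_trans (modc_distl _ _); rewrite !modcX modc_rho.
apply: le_trans (_ : (4 * B) ^+ M - B ^+ M <= _); last first.
  by rewrite lerB // lerXn2r // ?nnegrE ?modc_ge0 //; lraB.
rewrite exprMn -[X in _ <= _ - X]mul1r -mulrBl; apply: ler_wpM2r.
  by rewrite exprn_ge0 //; lraB.
rewrite -[X in _ <= _ - X](expr1n R M); elim: (M) M_gt0 => // -[|m] IH _.
  by rewrite !expr1; lraB.
rewrite exprS [4 ^+ _]exprS [1 ^+ _]exprS.
have := IH isT; have : 0 <= 2 ^+ m.+1 :> R by rewrite exprn_ge0.
have : 0 <= 1 ^+ m.+1 :> R by rewrite exprn_ge0.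
move: (2 ^+ _) (1 ^+ _) (4 ^+ _) => x y' z'; lraB.
Qed.

Lemma ratio_le a b (K L : R) : modc a <= K -> L <= modc b -> 0 < L ->
  modc (a / b) <= K / L.
Proof.
move=> aK Lb L0; rewrite modcM modcV; apply: ler_pM => //; rewrite ?modc_ge0 ?invr_ge0 ?modc_ge0 //.
by rewrite lef_pV2 // posrE; apply: lt_le_trans Lb.
Qed.

Definition interp f z := gavg (fun l => f l * geom M (z / l)).

Lemma kernel_outer z u : modc z <= B -> modc u = 3 * (4 * B) ->
  modc (u / (u - z) - u / (u - z) * ((u ^+ M - z ^+ M) / (u ^+ M - rho ^+ M)))
    <= 4 / 2 ^+ M.
Proof.
move=> zB uR.
have d := den_large (lexx 3) uR.
have L0 : 0 < 2 ^+ M * (4 * B) ^+ M.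
  by rewrite mulr_gt0 // exprn_gt0 //; lraB.
have d0 : u ^+ M - rho ^+ M != 0 by rewrite -modc_gt0; exact: lt_le_trans d.
have -> : u / (u - z) - u / (u - z) * ((u ^+ M - z ^+ M) / (u ^+ M - rho ^+ M))
   = u / (u - z) * ((z ^+ M - rho ^+ M) / (u ^+ M - rho ^+ M)).
  move: d0; move: (u / _) (u ^+ M) (rho ^+ M) (z ^+ M) => a b c e h; by field.
rewrite modcM; have -> : 4 / 2 ^+ M = 2 * (2 / 2 ^+ M) :> R by lraB.
apply: ler_pM; rewrite ?modc_ge0 //.
  have := modc_distl u z; rewrite uR modcM modcV => h.
  by rewrite ler_pdivrMr ?uR; lraB.
apply: le_trans (_ : 2 * (4 * B) ^+ M / (2 ^+ M * (4 * B) ^+ M) <= _).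
  apply: ratio_le => //.
  apply: le_trans (modc_expB zB (lexx _)) _; rewrite modc_rho [2 * (4 * B) ^+ _]mulr_natl mulr2n lerD2r.
  by rewrite lerXn2r // ?nnegrE; lraB.
rewrite -mulf_div divff ?mulr1 // expf_neq0 // gt_eqF //; lraB.
Qed.

(** The list encodes the functional f -> f z - interp f z in the form required by [cauchy_dual]. *)
Lemma interp_kernel f z u : u != z -> u ^+ M != rho ^+ M ->
  \sum_(p <- (1, z) :: [seq (- geom M (z / node j) / M%:R, node j) | j <- index_enum 'I_M])
     p.1 * (u / (u - p.2)) =
  u / (u - z) - u / (u - z) * ((u ^+ M - z ^+ M) / (u ^+ M - rho ^+ M)).
Proof.
move=> uz ur; rewrite big_cons big_map /= mul1r; congr (_ + _).
rewrite -(kernel_out (w := turn M%:R^-1) M_gt0 (prim_node N) rho_neq0) //.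
rewrite /avg mulr_suml -sumrN; apply: eq_bigr => j _; rewrite /node.
by move: (_ - _)^-1 => a; ring.
Qed.

Lemma interp_sum f z : \sum_(p <- (1, z) ::
    [seq (- geom M (z / node j) / M%:R, node j) | j <- index_enum 'I_M]) p.1 * f p.2
  = f z - interp f z.
Proof.
rewrite big_cons big_map /= mul1r /interp /gavg mulr_suml -sumrN; congr (_ + _).
by apply: eq_bigr => j _; ring.
Qed.

Lemma interp_disc f z S : (forall u, differentiable f u) ->
  (forall u, modc u <= 3 * (4 * B) -> modc (f u) <= S) -> modc z <= B ->
  modc (f z - interp f z) <= S * (4 / 2 ^+ M).
Proof.
move=> df fS.
have S0 : 0 <= S.
  by apply: le_trans (modc_ge0 (f 0)) (fS _ _); rewrite modc0; lraB.
have main y : y != 0 -> modc y <= B -> modc (f y - interp f y) <= S * (4 / 2 ^+ M).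
  move=> y0 yB; apply/ler_addgt0Pl => e e0.
  have my : 0 < modc y by rewrite modc_gt0.
  (* The inner circle is shrunk to the origin, where the kernel vanishes. *)
  set b := (4 * B) ^+ M; have b0 : 0 < b by rewrite exprn_gt0 //; lraB.
  pose L := 2 ^+ M * B ^+ M; have L0 : 0 < L by rewrite mulr_gt0 ?exprn_gt0.
  pose K := 2 / modc y * (2 * b / L).
  have K0 : 0 < K by rewrite mulr_gt0 // divr_gt0 //; lraB.
  pose d := Num.min (modc y / 2) (e / ((S + 1) * K)).
  have d0 : 0 < d by rewrite lt_min !divr_gt0 // mulr_gt0 //; lraB.
  have dy : d <= modc y / 2 by rewrite ge_min lexx.
  rewrite -interp_sum.
  have E : S * (e / (S + 1)) + e / (S + 1) = e by field; lraB.
  apply: le_trans (_ : S * (d * K + 4 / 2 ^+ M) <= _); last first.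
    have e1 : d * K <= e / (S + 1).
      rewrite ler_pdivlMr; last lraB.
      rewrite -mulrA [K * _]mulrC -ler_pdivlMr; first by rewrite ge_min lexx orbT.
      by rewrite mulr_gt0 //; lraB.
    have e2 : 0 <= e / (S + 1) by rewrite divr_ge0 //; lraB.
    by have := ler_wpM2l S0 e1; move: (4 / _) => a; lraB.
  apply: (cauchy_dual (r1 := d) (r2 := 3 * (4 * B))) => //.
  - move=> p; rewrite inE => /predU1P[->|/mapP[j _ ->]] /=; first lraB.
    by rewrite modc_node; lraB.
  - by move=> u uE; apply: fS; case: uE => ->; lraB.
  - move=> u ud.
    have uy : u != y by apply/eqP => Eu; move: ud dy; rewrite Eu; lraB.
    have uB : modc u <= B by lraB.
    have ur : u ^+ M != rho ^+ M by apply: modc_lt_neqX; [rewrite lt_eqF; lraB | lraB].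
    rewrite interp_kernel //.
    have d1 : u ^+ M - rho ^+ M != 0 by rewrite subr_eq0.
    have -> : u / (u - y) - u / (u - y) * ((u ^+ M - y ^+ M) / (u ^+ M - rho ^+ M))
      = u / (u - y) * ((y ^+ M - rho ^+ M) / (u ^+ M - rho ^+ M)).
      move: d1; move: (u / _) (u ^+ M) (rho ^+ M) (y ^+ M) => a1 b1 c1 e1 h; by field.
    rewrite modcM /K mulrA; apply: ler_pM; rewrite ?modc_ge0 //.
      have -> : d * (2 / modc y) = d / (modc y / 2) by field; rewrite gt_eqF.
      apply: ratio_le; [by rewrite ud | | lraB].
      by have := modc_distl y u; rewrite modc_subC; lraB.
    apply: ratio_le => //; last exact: den_small.
    apply: le_trans (modc_expB yB (lexx _)) _; rewrite modc_rho [2 * b]mulr_natl mulr2n lerD2r.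
    by rewrite lerXn2r // ?nnegrE; lraB.
  - move=> u uR.
    have uy : u != y by apply/eqP => Eu; move: uR; rewrite Eu; lraB.
    have ur : u ^+ M != rho ^+ M by apply: modc_lt_neqX; [rewrite uR gt_eqF; lraB | lraB].
    by rewrite interp_kernel //; exact: kernel_outer.
  - lraB.
(* The annulus of [main] leaves out its centre; there the bound follows by continuity of the
   error. *)
case: (eqVneq z 0) => [->|z0 zB]; last exact: main.
move=> _; apply/ler_addgt0Pl => e e0; set g := fun y => f y - interp f y.
have dg : differentiable g 0.
  apply: diff_sub; [exact: df | rewrite /interp /gavg].
  apply: diff_mul; last exact: diff_cst.
  apply: diff_bigsum => j _; apply: diff_mul; first exact: diff_cst.
  rewrite /geom; apply: diff_bigsum => m _; apply: diff_exp.
  by apply: diff_mul; [exact: diff_id | exact: diff_cst].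
have [d d0 Hd] := diff_continuous_eps dg e0.
pose c := Num.min (d / 2) B.
have c0 : 0 < c by rewrite lt_min B0 divr_gt0.
have mc : modc (ofR c : CC R) = c by rewrite modc_ofR gtr0_norm.
have cd : c <= d / 2 by rewrite ge_min lexx.
have cB : c <= B by rewrite ge_min lexx orbT.
have h1 : modc (g (ofR c) - g 0) <= e by apply: Hd; rewrite subr0 mc; lraB.
have h2 : modc (g (ofR c)) <= S * (4 / 2 ^+ M).
  by apply: main; rewrite ?mc // -modc_gt0 mc.
rewrite -/(g 0) -[g 0](subKr (g (ofR c))).
by apply: le_trans (modcB _ _) _; lraB.
Qed.

End Interpolation.

(** * Laurent interpolation on the conic xi_0 * eta_0 = t *)

Section Fibre.
Context {R : realType} (N : nat) (B : R).
Hypothesis B0 : 0 < B.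
Implicit Types (S : R) (z u v y t : CC R).

Local Notation M := (2 ^ N)%N.
Local Notation rho := (ofR (4 * B) : CC R).
Local Notation node := (@node R N B).
Local Notation gavg := (@gavg R N B).

Local Ltac lraB := have := B0; lra.

Lemma gavg_in v y : v ^+ M != rho ^+ M -> v != y ->
  gavg (fun l => l / (l - v) * (geom M (y / l) - 1)) =
  y / (y - v) * ((v ^+ M - v * y ^+ M.-1) / (v ^+ M - rho ^+ M)).
Proof.
move=> vr vy; rewrite -(kernel_in (w := turn M%:R^-1) (M_gt0 N) (prim_node N) (rho_neq0 B0)) //.
Qed.

(** The error functional in the variable xi_0. The first family is the part polynomial in xi_0; the
    second, with nodes t / l, is the part polynomial in eta_0, where [- 1] removes the constant term
    already present in the first. *)
Definition fibre_nodes z y t : seq (CC R * CC R) :=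
  (1, z) :: [seq (- geom M (z / node j) / M%:R, node j) | j <- index_enum 'I_M]
  ++ [seq (- (geom M (y / node j) - 1) / M%:R, t / node j) | j <- index_enum 'I_M].

Lemma fibre_sum (f : CC R -> CC R) z y t :
  \sum_(p <- fibre_nodes z y t) p.1 * f p.2 =
  f z - (interp N B f z + gavg (fun l => f (t / l) * (geom M (y / l) - 1))).
Proof.
rewrite /fibre_nodes -cat_cons big_cat /= interp_sum big_map /= opprD addrA.
congr (_ + _); rewrite /gavg mulr_suml -sumrN.
by apply: eq_bigr => j _; ring.
Qed.

Lemma node_neq0' j : node j != 0.
Proof. by rewrite -modc_gt0 modc_node //; lraB. Qed.

(** With v = z y / u one has u / (u - z y / l) = l / (l - v), so the second family becomes an
    interpolation in y, evaluated by [gavg_in]. *)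
Lemma fibre_kernel z y u (v := z * y / u) :
  z != 0 -> y != 0 -> u != 0 -> u != z -> u ^+ M != rho ^+ M -> v ^+ M != rho ^+ M ->
  \sum_(p <- fibre_nodes z y (z * y)) p.1 * (u / (u - p.2)) =
  u / (u - z) - u / (u - z) * ((u ^+ M - z ^+ M) / (u ^+ M - rho ^+ M))
  - y / (y - v) * ((v ^+ M - v * y ^+ M.-1) / (v ^+ M - rho ^+ M)).
Proof.
move=> z0 y0 u0 uz ur vr.
have vy : v != y.
  apply: contra uz => /eqP vy; apply/eqP/(mulIf y0).
  by rewrite -[in LHS]vy /v; field.
rewrite /fibre_nodes -cat_cons big_cat /= interp_kernel // big_map -gavg_in //=.
congr (_ + _); rewrite /gavg mulr_suml -sumrN; apply: eq_bigr => j _.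
have l0 := node_neq0' j; set l := node j in l0 *.
have lv : l - v != 0.
  rewrite subr_eq0; apply: contra vr => /eqP <-.
  by rewrite (node_expM _ (prim_node N)).
have ul : u - z * y / l != 0.
  have -> : u - z * y / l = u / l * (l - v) by rewrite /v; field; rewrite u0 l0.
  by rewrite !mulf_neq0 // invr_neq0.
have -> : u / (u - z * y / l) = l / (l - v).
  apply: (mulIf ul); rewrite divfK //; apply: (mulIf lv).
  rewrite mulrAC divfK // /v; field; rewrite u0 l0 //.
by ring.
Qed.

(** On the inner circle |v| = 12B. Because u / (u - z) = y / (y - v), the leading kernel now cancels
    against the interpolation in y, and the interpolation in z is small by itself. *)
Lemma inner_half z y u (v := z * y / u) : modc z <= B -> modc y <= B ->
  z != 0 -> y != 0 -> modc u = modc (z * y) / (3 * (4 * B)) ->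
  modc (\sum_(p <- fibre_nodes z y (z * y)) p.1 * (u / (u - p.2))) <= 6 / 2 ^+ M.
Proof.
move=> zB yB z0 y0 uE.
have mz : 0 < modc z by rewrite modc_gt0.
have my : 0 < modc y by rewrite modc_gt0.
have B12 : 0 < 3 * (4 * B) by lraB.
have mu : 0 < modc u by rewrite uE divr_gt0 // modcM mulr_gt0.
have u0 : u != 0 by rewrite -modc_gt0.
have vE : modc v = 3 * (4 * B).
  rewrite /v modcM modcV uE modcM; move: mz my.
  move: (modc z) (modc y) => a b a0 b0; field.
  by rewrite !gt_eqF //; lraB.
have uz : modc u <= modc z / 12.
  rewrite uE modcM ler_pdivrMr //.
  have -> : modc z / 12 * (3 * (4 * B)) = modc z * B by field.
  by apply: ler_wpM2l => //; exact: ltW.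
have uB : modc u <= B by lra.
have nuz : u != z by apply/eqP => E; move: uz; rewrite E; lra.
have ur : u ^+ M != rho ^+ M.
  by apply: modc_lt_neqX; [rewrite lt_eqF; lraB | lraB].
have vr : v ^+ M != rho ^+ M.
  by apply: modc_lt_neqX; [rewrite vE gt_eqF; lraB | lraB].
rewrite fibre_kernel // -/v.
have vy : v != y by apply/eqP => E; move: yB; rewrite -E vE; lraB.
have yv0 : y - v != 0 by rewrite subr_eq0 eq_sym.
have uz0 : u - z != 0 by rewrite subr_eq0.
have d1 : v ^+ M - rho ^+ M != 0 by rewrite subr_eq0.
have Euv : u / (u - z) = y / (y - v).
  apply: (mulIf uz0); rewrite divfK //; apply: (mulIf yv0).
  by rewrite mulrAC divfK // /v; field.
have -> : u / (u - z) - u / (u - z) * ((u ^+ M - z ^+ M) / (u ^+ M - rho ^+ M))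
   - y / (y - v) * ((v ^+ M - v * y ^+ M.-1) / (v ^+ M - rho ^+ M)) =
   y / (y - v) * ((v * y ^+ M.-1 - rho ^+ M) / (v ^+ M - rho ^+ M))
   - u / (u - z) * ((u ^+ M - z ^+ M) / (u ^+ M - rho ^+ M)).
  rewrite {1}Euv; move: (_ / (u ^+ M - _)) (y / _) (u / _) d1 (y ^+ _).
  move: (v ^+ M) (rho ^+ M) => a b c e g h k; by field.
apply: le_trans (modcB _ _) _.
have -> : 6 / 2 ^+ M = 1 * (4 / 2 ^+ M) + 1 * (2 / 2 ^+ M) :> R by lra.
have BM0 : 0 < B ^+ M by rewrite exprn_gt0.
have rM0 : 0 < (4 * B) ^+ M by rewrite exprn_gt0 //; lraB.
have tM0 : 0 < 2 ^+ M :> R by rewrite exprn_gt0.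
apply: lerD; rewrite modcM; apply: ler_pM; rewrite ?modc_ge0 //.
- have h := modc_distl v y; rewrite modc_subC vE in h.
  by rewrite modcM modcV ler_pdivrMr; lraB.
- apply: le_trans (_ : 4 * (4 * B) ^+ M / (2 ^+ M * (4 * B) ^+ M) <= _).
    apply: ratio_le; [|exact: (den_large N B0 (lexx 3) vE) | exact: mulr_gt0].
    apply: le_trans (modcB _ _) _; rewrite modcM !modcX vE modc_rho //.
    have h1 : modc y ^+ M.-1 <= B ^+ M.-1 by rewrite lerXn2r // ?nnegrE ?modc_ge0 // ltW.
    have h2 : 3 * (4 * B) * modc y ^+ M.-1 <= 12 * B ^+ M.
      have -> : 12 * B ^+ M = 3 * (4 * B) * B ^+ M.-1.
        by rewrite -{1}(prednK (M_gt0 N)) exprS; ring.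
      by apply: ler_wpM2l => //; exact: ltW.
    have h3 : 4 * B ^+ M <= (4 * B) ^+ M.
      rewrite exprMn; apply: ler_wpM2r; first exact: ltW.
      by rewrite -{1}[4]expr1; apply: ler_weXn2l; [lra | exact: M_gt0].
    lra.
  by rewrite -mulf_div divff ?mulr1 // gt_eqF.
- have h := modc_distl z u; rewrite modc_subC in h.
  by rewrite modcM modcV ler_pdivrMr; lraB.
- apply: le_trans (_ : 2 * B ^+ M / (2 ^+ M * B ^+ M) <= _).
    apply: ratio_le; [|exact: den_small | exact: mulr_gt0].
    by apply: le_trans (modc_expB N uB zB) _; rewrite mulr_natl mulr2n.
  by rewrite -mulf_div divff ?mulr1 // gt_eqF.
Qed.

(** On the outer circle the leading kernel cancels against the interpolation in z as in
    [kernel_outer]; the part in y is small since |v| <= |y| / 12. *)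
Lemma outer_half z y u (v := z * y / u) : modc z <= B -> modc y <= B ->
  z != 0 -> y != 0 -> modc u = 3 * (4 * B) ->
  modc (\sum_(p <- fibre_nodes z y (z * y)) p.1 * (u / (u - p.2))) <= 8 / 2 ^+ M.
Proof.
move=> zB yB z0 y0 uE.
have mz : 0 < modc z by rewrite modc_gt0.
have my : 0 < modc y by rewrite modc_gt0.
have B12 : 0 < 3 * (4 * B) by lraB.
have u0 : u != 0 by rewrite -modc_gt0 uE.
have vy : modc v <= modc y / 12.
  rewrite /v !modcM modcV uE ler_pdivrMr //.
  have -> : modc y / 12 * (3 * (4 * B)) = B * modc y by field.
  by apply: ler_wpM2r => //; exact: ltW.
have vB : modc v <= B by lra.
have nuz : u != z by apply/eqP => E; move: zB; rewrite -E uE; lraB.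
have nvy : v != y by apply/eqP => E; move: vy; rewrite E; lra.
have ur : u ^+ M != rho ^+ M.
  by apply: modc_lt_neqX; [rewrite uE gt_eqF; lraB | lraB].
have vr : v ^+ M != rho ^+ M.
  by apply: modc_lt_neqX; [rewrite lt_eqF; lraB | lraB].
rewrite fibre_kernel // -/v; apply: le_trans (modcB _ _) _.
have -> : 8 / 2 ^+ M = 4 / 2 ^+ M + 2 * (2 / 2 ^+ M) :> R by lra.
have BM0 : 0 < B ^+ M by rewrite exprn_gt0.
have tM0 : 0 < 2 ^+ M :> R by rewrite exprn_gt0.
apply: lerD; first exact: kernel_outer.
rewrite modcM; apply: ler_pM; rewrite ?modc_ge0 //.
  have h := modc_distl y v.
  by rewrite modcM modcV ler_pdivrMr; lraB.
apply: le_trans (_ : 2 * B ^+ M / (2 ^+ M * B ^+ M) <= _).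
  apply: ratio_le; [|exact: den_small | exact: mulr_gt0].
  apply: le_trans (modcB _ _) _; rewrite modcM !modcX mulr_natl mulr2n.
  apply: lerD; first by rewrite lerXn2r // ?nnegrE ?modc_ge0 // ltW.
  rewrite -[in leRHS](prednK (M_gt0 N)) exprS.
  apply: ler_pM; rewrite ?exprn_ge0 ?modc_ge0 //.
  by rewrite lerXn2r // ?nnegrE ?modc_ge0 // ltW.
by rewrite -mulf_div divff ?mulr1 // gt_eqF.
Qed.

Lemma fibre_approx_nonzero (f : CC R -> CC R) z y S : z != 0 -> y != 0 ->
  modc z <= B -> modc y <= B -> (forall u, u != 0 -> differentiable f u) ->
  (forall u, u != 0 -> modc u <= 3 * (4 * B) -> modc (z * y / u) <= 3 * (4 * B) ->
     modc (f u) <= S) ->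
  modc (f z - (interp N B f z + gavg (fun l => f (z * y / l) * (geom M (y / l) - 1))))
    <= S * (16 / 2 ^+ M).
Proof.
move=> z0 y0 zB yB df fS.
have mz : 0 < modc z by rewrite modc_gt0.
have my : 0 < modc y by rewrite modc_gt0.
have B12 : 0 < 3 * (4 * B) by lraB.
have mt : 0 < modc (z * y) by rewrite modcM mulr_gt0.
have tB : modc (z * y) <= B * modc z by rewrite modcM mulrC ler_wpM2r // ltW.
have tB' : modc (z * y) <= B * B.
  by apply: le_trans tB _; apply: ler_wpM2l => //; lraB.
have S0 : 0 <= S.
  apply: le_trans (modc_ge0 (f z)) (fS _ z0 _ _); first lraB.
  have -> : z * y / z = y by field.
  lraB.
(* 6 and 8 are the kernel bounds on the inner and outer circle. The constant 16 exceeds their sum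
   and also covers the degenerate fibre, where up to three errors of size 4 occur. *)
rewrite -fibre_sum; apply: le_trans (_ : S * (6 / 2 ^+ M + 8 / 2 ^+ M) <= _); last first.
  have : 0 < 2 ^+ M :> R by rewrite exprn_gt0.
  rewrite -invr_gt0; move: (2 ^+ M)^-1 => a a0.
  by apply: ler_wpM2l => //; lra.
apply: (cauchy_dual (r1 := modc (z * y) / (3 * (4 * B))) (r2 := 3 * (4 * B))) => //.
- exact: divr_gt0.
- move=> w /andP[w1 _]; apply: df; rewrite -modc_gt0; apply: lt_le_trans w1.
  exact: divr_gt0.
- have small x : 0 < x -> modc (z * y) < 12 * B * x ->
      modc (z * y) / (3 * (4 * B)) < x.
    by move=> x0 h; rewrite ltr_pdivrMr //; lra.
  move=> p; rewrite inE => /predU1P[->|]; rewrite ?mem_cat /=.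
    rewrite small //=; first lraB.
    apply: le_lt_trans tB _; rewrite -subr_gt0.
    have -> : 12 * B * modc z - B * modc z = 11 * (B * modc z) by ring.
    by rewrite !mulr_gt0.
  have B4 : 0 < 4 * B by lraB.
  move=> /orP[] /mapP[j _ ->] /=.
    rewrite modc_node //; apply/andP; split; last lraB.
    apply: small => //; apply: le_lt_trans tB' _; rewrite -subr_gt0.
    have -> : 12 * B * (4 * B) - B * B = 47 * (B * B) by ring.
    by rewrite !mulr_gt0.
  rewrite (modcM (z * y)) modcV modc_node //; apply/andP; split.
    rewrite ltr_pM2l // ltf_pV2 ?posrE //; lraB.
  rewrite ltr_pdivrMr //; apply: le_lt_trans tB' _; rewrite -subr_gt0.
  have -> : 3 * (4 * B) * (4 * B) - B * B = 47 * (B * B) by ring.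
  by rewrite !mulr_gt0.
- have h : modc (z * y) / (3 * (4 * B)) <= 3 * (4 * B).
    rewrite ler_pdivrMr //; apply: le_trans tB' _; rewrite -subr_ge0.
    have -> : 3 * (4 * B) * (3 * (4 * B)) - B * B = 143 * (B * B) by ring.
    by rewrite !mulr_ge0 // ltW.
  move=> w wE; have w0 : w != 0.
    by rewrite -modc_gt0; case: wE => ->; rewrite ?divr_gt0.
  apply: fS => //; first by case: wE => ->.
  case: wE => wE; rewrite (modcM (z * y)) modcV wE; last exact: h.
  by rewrite invf_div mulrC divfK // gt_eqF.
- by move=> w wE; apply: inner_half.
- by move=> w wE; apply: outer_half.
Qed.

(** For z y = 0 the fibre consists of the two axes. There Phi restricts to entire functions f and g
    with f 0 = g 0, each interpolated by [interp_disc]; the second average becomes interp g y -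
    interp g 0. *)
Lemma fibre_approx (Phi : CC R -> CC R -> CC R) z y S :
  modc z <= B -> modc y <= B ->
  (forall u, u != 0 -> differentiable (fun u => Phi u (z * y / u)) u) ->
  (z * y = 0 -> forall u,
     differentiable (fun u => Phi u 0) u /\ differentiable (Phi 0) u) ->
  (forall a b, a * b = z * y -> modc a <= 3 * (4 * B) -> modc b <= 3 * (4 * B) ->
     modc (Phi a b) <= S) ->
  modc (Phi z y - (gavg (fun l => Phi l (z * y / l) * geom M (z / l))
     + gavg (fun l => Phi (z * y / l) l * (geom M (y / l) - 1))))
    <= S * (16 / 2 ^+ M).
Proof.
move=> zB yB dPhi dPhi0 PS.
have S0 : 0 <= S.
  by apply: le_trans (modc_ge0 (Phi z y)) (PS _ _ _ _ _) => //; lraB.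
case: (eqVneq (z * y) 0) => [t0|t0]; last first.
  move: (t0); rewrite mulf_eq0 negb_or => /andP[z0 y0].
  have := @fibre_approx_nonzero (fun u => Phi u (z * y / u)) z y S z0 y0 zB yB dPhi.
  have -> : Phi z (z * y / z) = Phi z y by congr Phi; field.
  have -> : gavg (fun l => Phi (z * y / l) (z * y / (z * y / l)) * (geom M (y / l) - 1))
    = gavg (fun l => Phi (z * y / l) l * (geom M (y / l) - 1)).
    congr (_ / _); apply: eq_bigr => j _; congr (Phi _ _ * _).
    by field; rewrite z0 y0 node_neq0'.
  by apply => u u0 uB tB; apply: PS => //; field.
have d0 := dPhi0 t0.
pose f u := Phi u 0; pose g := Phi 0.
have fS u : modc u <= 3 * (4 * B) -> modc (f u) <= S.
  by move=> uB; apply: PS; rewrite ?mulr0 ?t0 ?modc0 //; lraB.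
have gS u : modc u <= 3 * (4 * B) -> modc (g u) <= S.
  by move=> uB; apply: PS; rewrite ?mul0r ?t0 ?modc0 //; lraB.
have Hf u : modc u <= B -> modc (f u - interp N B f u) <= S * (4 / 2 ^+ M).
  by move=> uB; apply: interp_disc => // w; have [] := d0 w.
have Hg u : modc u <= B -> modc (g u - interp N B g u) <= S * (4 / 2 ^+ M).
  by move=> uB; apply: interp_disc => // w; have [] := d0 w.
have z0B : modc (0 : CC R) <= B by rewrite modc0; lraB.
have geom0 : geom M (0 : CC R) = 1.
  rewrite /geom (bigD1 (Ordinal (M_gt0 N))) //= big1 ?addr0 // => m m0.
  by rewrite expr0n; case: eqP => // h; case/eqP: m0; apply: val_inj.
have i0 (h : CC R -> CC R) : interp N B h 0 = gavg h.
  by congr (_ / _); apply: eq_bigr => j _; rewrite mul0r geom0 mulr1.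
have E1 : gavg (fun l => Phi l (z * y / l) * geom M (z / l)) = interp N B f z.
  by congr (_ / _); apply: eq_bigr => j _; rewrite t0 mul0r.
have E2 : gavg (fun l => Phi (z * y / l) l * (geom M (y / l) - 1)) =
    interp N B g y - interp N B g 0.
  rewrite i0 /interp /gavg -mulrBl -sumrB; congr (_ / _).
  by apply: eq_bigr => j _; rewrite t0 mul0r mulrBr mulr1.
have e2 : 0 <= S * (4 / 2 ^+ M) by rewrite mulr_ge0 // divr_ge0 // exprn_ge0.
have E16 : S * (16 / 2 ^+ M) = 4 * (S * (4 / 2 ^+ M)) by move: (2 ^+ M)^-1 => a; ring.
have fg : f 0 = g 0 by [].
rewrite E1 E2 E16; move: e2 (Hf z zB) (Hg y yB) (Hg 0 z0B).
have : z = 0 \/ y = 0 by move/eqP: t0; rewrite mulf_eq0 => /orP[]/eqP; [left|right].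
(* On the axis z = 0 the common value f 0 = g 0 is inserted, at the cost of two further errors at 0;
   on y = 0 the g-terms cancel. *)
move=> [z0|y0] e2.
- have := Hf 0 z0B; rewrite z0 => h1 h2 h3 h4.
  have -> : Phi 0 y - (interp N B f 0 + (interp N B g y - interp N B g 0)) =
    (f 0 - interp N B f 0) + (g y - interp N B g y) - (g 0 - interp N B g 0).
    by rewrite fg /g; ring.
  apply: le_trans (modcB _ _) _; apply: le_trans (lerD (modcD _ _) (lexx _)) _.
  lra.
- rewrite y0 => h1 h2 _.
  have -> : Phi z 0 - (interp N B f z + (interp N B g 0 - interp N B g 0)) =
    f z - interp N B f z by rewrite subrr addr0.
  lra.
Qed.

End Fibre.

(** * Polynomial approximation of entire functions *)

Section PolynomialFunctions.
Context {R : realType} {d : nat}.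
Implicit Types (F G : ('I_d -> CC R) -> CC R) (x : 'I_d -> CC R).

Definition polynomial_fun F :=
  exists p : mpoly.mpoly d (CC R), forall x, F x = mpoly.meval x p.

Lemma polynomial_cst a : polynomial_fun (fun _ => a).
Proof. by exists (mpoly.mpolyC d a) => x; rewrite mpoly.mevalC. Qed.

Lemma polynomial_coord i : polynomial_fun (fun x => x i).
Proof. by exists (mpoly.mpolyX _ (mpoly.mnm1 i)) => x; rewrite mpoly.mevalXU. Qed.

Lemma polynomial_add F G : polynomial_fun F -> polynomial_fun G ->
  polynomial_fun (fun x => F x + G x).
Proof.
by move=> [p Hp] [q Hq]; exists (p + q) => x; rewrite mpoly.mevalD Hp Hq.
Qed.

Lemma polynomial_mul F G : polynomial_fun F -> polynomial_fun G ->
  polynomial_fun (fun x => F x * G x).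
Proof.
by move=> [p Hp] [q Hq]; exists (p * q) => x; rewrite mpoly.mevalM Hp Hq.
Qed.

Lemma polynomial_exp F n : polynomial_fun F -> polynomial_fun (fun x => F x ^+ n).
Proof.
by move=> [p Hp]; exists (p ^+ n) => x; rewrite rmorphXn /= Hp.
Qed.

Lemma polynomial_sum n (F : 'I_n -> ('I_d -> CC R) -> CC R) :
  (forall i, polynomial_fun (F i)) -> polynomial_fun (fun x => \sum_(i < n) F i x).
Proof.
move=> /choice[p Hp]; exists (\sum_i p i) => x.
by rewrite raddf_sum; apply: eq_bigr.
Qed.

Definition upd x k (z : CC R) : 'I_d -> CC R := fun i => if i == k then z else x i.

(** Separate differentiability and bounds on polydiscs are all that interpolation in one coordinate
    at a time uses, and both survive freezing a coordinate. *)
Definition entire F :=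
  (forall x k z, differentiable (fun z => F (upd x k z)) z) /\
  forall C : R, exists S : R, forall x, (forall i, modc (x i) <= C) ->
    modc (F x) <= S.

Lemma upd_upd x k z w : upd (upd x k z) k w = upd x k w.
Proof. by apply/funext => i; rewrite /upd; case: (i == k). Qed.

Lemma updC x k l z w : k != l -> upd (upd x k z) l w = upd (upd x l w) k z.
Proof.
by move=> kl; apply/funext => i; rewrite /upd; case: (eqVneq i l) => // ->;
  rewrite eq_sym (negPf kl).
Qed.

Lemma upd_id x k : upd x k (x k) = x.
Proof. by apply/funext => i; rewrite /upd; case: eqP => [->|]. Qed.

Lemma entire_upd F k z : entire F -> entire (fun x => F (upd x k z)).
Proof.
move=> [dF bF]; split => [x l w|C].
  have [<-|kl] := eqVneq k l.
    rewrite (_ : (fun w => _) = fun=> F (upd x k z)); first exact: diff_cst.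
    by apply/funext => w'; rewrite upd_upd.
  rewrite (_ : (fun w => _) = fun w => F (upd (upd x k z) l w)); first exact: dF.
  by apply/funext => w'; rewrite updC // eq_sym.
have [S HS] := bF (Num.max C (modc z)); exists S => x xC; apply: HS => i.
by rewrite /upd; case: ifP => _; rewrite le_max ?lexx ?xC ?orbT.
Qed.

Lemma modc_geom (M : nat) (z : CC R) : modc z <= 1 -> modc (geom M z) <= M%:R.
Proof.
move=> z1; apply: le_trans (modc_sum _ _ _) _.
rewrite -[leRHS]mulr1 -[X in X%:R * _](card_ord M) mulr_natl -sumr_const.
by apply: ler_sum => m _; rewrite modcX exprn_ile1 ?modc_ge0.
Qed.

Lemma pow_small (S e : R) : 0 < e -> exists N, S / 2 ^+ (2 ^ N) <= e.
Proof.
move=> e0; pose S' := `|S| + 1; have S0 : 0 < S' by rewrite ltr_wpDl.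
have [N HN] : exists N, S' / e < N%:R.
  by exists (Num.bound (S' / e)); apply: archi_boundP; rewrite divr_ge0 // ltW.
exists N; rewrite ler_pdivrMr ?exprn_gt0 //.
have h1 : S <= S' by rewrite /S'; have := ler_norm S; lra.
apply: le_trans h1 _; move: HN; rewrite ltr_pdivrMr // => /ltW h.
apply: le_trans h _; rewrite mulrC; apply: ler_wpM2l; first exact: ltW.
rewrite -natrX ler_nat; apply: (@leq_trans (2 ^ N)%N);
  by apply: ltnW; exact: ltn_expl.
Qed.

(* The coefficients of the interpolation polynomial in one coordinate are
   values of F, so they are again entire, in one coordinate less: no
   holomorphy of Taylor coefficients is needed. *)
Lemma entire_approx F (C e : R) : entire F -> 0 < C -> 0 < e ->
  exists2 P, polynomial_fun P &
    forall x, (forall i, modc (x i) <= C) -> modc (F x - P x) <= e.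
Proof.
move=> + C0.
(* Induction on the number k of leading coordinates on which G depends; for k = 0 it is constant. *)
suff H k : (k <= d)%N -> forall G, entire G ->
    (forall x y, (forall i : 'I_d, (i < k)%N -> x i = y i) -> G x = G y) ->
    forall e', 0 < e' -> exists2 P, polynomial_fun P &
      forall x, (forall i, modc (x i) <= C) -> modc (G x - P x) <= e'.
  move=> eF; apply: (H d) => // x y xy.
  by congr F; apply/funext => i; apply: xy.
elim: k => [_ G _ Gc e' e'0|k IH kd G eG Gk e' e'0].
  exists (fun=> G (fun=> 0)); first exact: polynomial_cst.
  by move=> x _; rewrite (Gc x (fun=> 0)) // subrr modc0 ltW.
pose K := Ordinal kd; have [dG /(_ (3 * (4 * C))) [S HS]] := eG.
have e2 : 0 < e' / 2 by rewrite divr_gt0.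
have [N HN] := pow_small (S * 4) e2.
pose M := (2 ^ N)%N; have M0 : 0 < M%:R :> R by rewrite ltr0n expn_gt0.
(* Each coefficient is multiplied by a [geom] of modulus at most M before averaging, so this
   accuracy contributes e' / 2. *)
have eM : 0 < e' / (2 * M%:R) by rewrite divr_gt0 // mulr_gt0.
have /choice[P HP] (j : 'I_M) : exists P : ('I_d -> CC R) -> CC R,
    polynomial_fun P /\ forall x, (forall i, modc (x i) <= C) ->
      modc (G (upd x K (node C j)) - P x) <= e' / (2 * M%:R).
  have Hc x y : (forall i : 'I_d, (i < k)%N -> x i = y i) ->
      G (upd x K (node C j)) = G (upd y K (node C j)).
    move=> xy; apply: Gk => i; rewrite ltnS leq_eqVlt /upd => /orP[/eqP ik|ik].
      by rewrite (_ : i == K) //; apply/eqP/val_inj.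
    by rewrite xy.
  by have [P pP HP] := IH (ltnW kd) _ (entire_upd K (node C j) eG) Hc _ eM; exists P.
exists (fun x => (\sum_(j < M) P j x * geom M (x K / node C j)) / M%:R).
  apply: polynomial_mul; last exact: polynomial_cst.
  apply: polynomial_sum => j; apply: polynomial_mul; first by have [] := HP j.
  apply: polynomial_sum => m; apply: polynomial_exp.
  by apply: polynomial_mul; [exact: polynomial_coord | exact: polynomial_cst].
move=> x xC; set Px := _ / _.
pose f z := G (upd x K z).
have h1 : modc (f (x K) - interp N C f (x K)) <= e' / 2.
  apply: le_trans HN; rewrite -mulrA; apply: interp_disc => //; first exact: dG.
  move=> u uC; apply: HS => i; rewrite /upd; case: ifP => // _.
  by apply: le_trans (xC i) _; lra.
have h2 : modc (interp N C f (x K) - Px) <= e' / 2.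
  rewrite /interp /gavg /Px -mulrBl -sumrB modcM modcV modc_nat ler_pdivrMr //.
  apply: le_trans (modc_sum _ _ _) _.
  have -> : e' / 2 * M%:R = \sum_(j < M) e' / (2 * M%:R) * M%:R.
    by rewrite sumr_const card_ord -[RHS]mulr_natr; field; rewrite gt_eqF.
  apply: ler_sum => j _; rewrite -mulrBl modcM; apply: ler_pM; rewrite ?modc_ge0 //.
    by have [_] := HP j; apply.
  apply: modc_geom; rewrite modcM modcV modc_node // ler_pdivrMr ?mul1r; last lra.
  by apply: le_trans (xC K) _; lra.
have -> : G x = f (x K) by rewrite /f upd_id.
rewrite -[f (x K)](subrK (interp N C f (x K))) -addrA.
by apply: le_trans (modcD _ _) _; lra.
Qed.

End PolynomialFunctions.

(** * Holomorphic functions on Mhat in homogeneous coordinates *)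

Lemma diff_row (K : numFieldType) (V : normedModType K) n
    (f : 'I_n -> V -> K) (x : V) :
  (forall k, differentiable (f k) x) ->
  differentiable (fun y => \row_k f k y : 'rV[K]_n) x.
Proof.
move=> df.
have -> : (fun y => \row_k f k y : 'rV[K]_n) =
    \sum_(k < n) (fun y => f k y *: delta_mx 0 k).
  apply/funext => y; rewrite fct_sumE; apply/rowP => j.
  rewrite mxE summxE (bigD1 j) //= big1 ?addr0; last first.
    by move=> k kj; rewrite !mxE /= eq_sym (negPf kj) mulr0.
  by rewrite !mxE !eqxx mulr1.
by apply: differentiable_sum => k; exact: differentiableZl.
Qed.

Lemma diff_near_neq0 (K : numFieldType) (V : normedModType K) (f : V -> K) (x : V) :
  differentiable f x -> f x != 0 -> \forall y \near x, f y != 0.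
Proof.
move=> /differentiable_continuous cf fx; exact: (cvgr_neq0 _ cf).
Qed.

Section MhatFunctions.
Context (R : realType) (n s : nat).
Local Notation C := (CC R).
Local Notation d := (n.+1 + n.+1)%N.
Implicit Types (xi eta : 'rV[C]_n.+1) (x : 'I_d -> C) (g : Mhat R n s -> C).

Definition xi_of x : 'rV[C]_n.+1 := \row_k x (lshift n.+1 k).
Definition eta_of x : 'rV[C]_n.+1 := \row_k x (rshift n.+1 k).

Definition ev g xi eta : C := oapp g 0 (Mhat_point s xi eta).

Definition Jx x : C := Jhat s (xi_of x) (eta_of x).

Lemma JhatZ a b xi eta : Jhat s (a *: xi) (b *: eta) = a * b * Jhat s xi eta.
Proof.
by rewrite /Jhat mulr_sumr; apply: eq_bigr => k _; rewrite !mxE; ring.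
Qed.

Lemma ZhatP xi eta : Jhat s xi eta = 1 -> (xi, eta) \in Zhat R n s.
Proof. by move=> J1; rewrite inE. Qed.

Lemma Mhat_point_Zhat xi eta (H : Jhat s xi eta = 1) :
  Mhat_point s xi eta = Some (\pi_(Mhat R n s) (Sub (xi, eta) (ZhatP H))).
Proof.
rewrite /Mhat_point H invr1 scale1r.
by rewrite (insubT (fun p => p \in Zhat R n s) (ZhatP H)).
Qed.

(** Independent scalings of xi and eta are allowed: the normalisation by Jhat absorbs one, the
    action of C^* the other. *)
Lemma Mhat_point_scale a b xi eta : a != 0 -> b != 0 ->
  Mhat_point s (a *: xi) (b *: eta) = Mhat_point s xi eta.
Proof.
move=> a0 b0; rewrite /Mhat_point JhatZ scalerA.
have [J0|J0] := eqVneq (Jhat s xi eta) 0.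
  (* As 0^-1 = 0, a vanishing Jhat turns the first component into 0, and both sides are [None]. *)
  have N0 e : (0, e) \notin Zhat R n s.
    apply/negP => /set_mem /esym/eqP.
    by rewrite /Jhat big1 ?oner_eq0 // => k _; rewrite mxE mulr0 mul0r.
  by rewrite J0 mulr0 !invr0 mul0r !scale0r !insubN ?N0.
have J1 : Jhat s ((Jhat s xi eta)^-1 *: xi) eta = 1.
  by rewrite -[eta in X in Jhat _ _ X]scale1r JhatZ mulr1 mulVf.
have J2 : Jhat s (((a * b * Jhat s xi eta)^-1 * a) *: xi) (b *: eta) = 1.
  by rewrite JhatZ; field; rewrite a0 b0 J0.
rewrite (insubT (fun p => p \in Zhat R n s) (ZhatP J1)).
rewrite (insubT (fun p => p \in Zhat R n s) (ZhatP J2)) /=.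
congr Some; apply/esym/eqmodP/asboolP; exists b^-1.
rewrite invr_eq0 b0 invrK; split => //=; congr pair.
by rewrite scalerA; congr (_ *: _); field; rewrite a0 b0 J0.
Qed.

Lemma affineE (i : 'I_n.+1) xi : xi 0 i != 0 ->
  xi = xi 0 i *: affine i (\row_k (xi 0 (lift i k) / xi 0 i)).
Proof.
move=> xi0; apply/rowP => k; rewrite !mxE.
case: unliftP => [j ->|->] /=; last by rewrite mulr1.
by rewrite mxE; field.
Qed.

(** Since Jhat is nonzero at c z, some coordinates xi_i and eta_j are nonzero there, hence also
    nearby; scale invariance identifies the function with its expression in the chart (i, j). The
    source V is general so as to cover both slices and the whole space. *)
Lemma ev_diff (V : normedModType C) g (c : V -> 'I_d -> C) (z : V) :
  holomorphic g -> (forall k, differentiable (fun y => c y k) z) ->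
  Jx (c z) != 0 -> differentiable (fun y => ev g (xi_of (c y)) (eta_of (c y))) z.
Proof.
move=> hg dc Jz.
have [i xi0] : exists i, xi_of (c z) 0 i != 0.
  apply: contrapT => H; case/negP: Jz; apply/eqP/big1 => k _.
  suff -> : xi_of (c z) 0 k = 0 by rewrite mulr0 mul0r.
  by apply: contrapT => /eqP h; apply: H; exists k.
have [j et0] : exists j, eta_of (c z) 0 j != 0.
  apply: contrapT => H; case/negP: Jz; apply/eqP/big1 => k _.
  suff -> : eta_of (c z) 0 k = 0 by rewrite mulr0.
  by apply: contrapT => /eqP h; apply: H; exists k.
pose u (y : V) : 'rV[C]_n :=
  \row_k (c y (lshift n.+1 (lift i k)) / c y (lshift n.+1 i)).
pose v (y : V) : 'rV[C]_n :=
  \row_k (c y (rshift n.+1 (lift j k)) / c y (rshift n.+1 j)).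
have xi0' : c z (lshift n.+1 i) != 0 by move: xi0; rewrite mxE.
have et0' : c z (rshift n.+1 j) != 0 by move: et0; rewrite mxE.
have uE y : u y = \row_k (xi_of (c y) 0 (lift i k) / xi_of (c y) 0 i).
  by apply/rowP => k; rewrite !mxE.
have vE y : v y = \row_k (eta_of (c y) 0 (lift j k) / eta_of (c y) 0 j).
  by apply/rowP => k; rewrite !mxE.
have du : differentiable u z.
  by apply: diff_row => k; apply: diff_mul; [exact: dc | exact: (diff_inv xi0' (dc _))].
have dv : differentiable v z.
  by apply: diff_row => k; apply: diff_mul; [exact: dc | exact: (diff_inv et0' (dc _))].
pose F (w : 'rV[C]_n * 'rV[C]_n) : C :=
  oapp g 0 (Mhat_point s (affine i w.1) (affine j w.2)).
have dF : differentiable F (u z, v z).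
  apply: hg => /=; move: Jz; rewrite /Jx {1}(affineE xi0) {1}(affineE et0) JhatZ.
  by rewrite -uE -vE; apply: contra => /eqP ->; rewrite mulr0.
apply: (@near_eq_differentiable _ _ _ (F \o (fun y => (u y, v y)))); last first.
  by apply: differentiable_comp => //; exact: differentiable_pair.
near=> y; rewrite /F /= /ev.
have xy : xi_of (c y) 0 i != 0.
  by rewrite mxE; near: y; exact: diff_near_neq0.
have ey : eta_of (c y) 0 j != 0.
  by rewrite mxE; near: y; exact: diff_near_neq0.
rewrite [in RHS](affineE xy) [in RHS](affineE ey) Mhat_point_scale //.
by rewrite -uE -vE.
Unshelve. all: by end_near. Qed.

Definition row_coords (p : 'rV[C]_n.+1 * 'rV[C]_n.+1) : 'I_d -> C :=
  fun k => match fintype.split k with inl i => p.1 0 i | inr i => p.2 0 i end.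

Lemma xi_of_coords p : xi_of (row_coords p) = p.1.
Proof. by apply/rowP => k; rewrite mxE /row_coords (unsplitK (inl k)). Qed.

Lemma eta_of_coords p : eta_of (row_coords p) = p.2.
Proof. by apply/rowP => k; rewrite mxE /row_coords (unsplitK (inr k)). Qed.

Lemma diff_fst_coord i (p : 'rV[C]_n.+1 * 'rV[C]_n.+1) :
  differentiable (fun q : 'rV[C]_n.+1 * 'rV[C]_n.+1 => q.1 0 i) p.
Proof.
apply: (@differentiable_comp _ _ _ _ fst (fun M : 'rV[C]_n.+1 => M 0 i)).
  by apply: linear_differentiable => q; exact: cvg_fst.
exact: differentiable_coord.
Qed.

Lemma diff_snd_coord i (p : 'rV[C]_n.+1 * 'rV[C]_n.+1) :
  differentiable (fun q : 'rV[C]_n.+1 * 'rV[C]_n.+1 => q.2 0 i) p.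
Proof.
apply: (@differentiable_comp _ _ _ _ snd (fun M : 'rV[C]_n.+1 => M 0 i)).
  by apply: linear_differentiable => q; exact: cvg_snd.
exact: differentiable_coord.
Qed.

Lemma diff_coords k (p : 'rV[C]_n.+1 * 'rV[C]_n.+1) :
  differentiable (fun q => row_coords q k) p.
Proof.
rewrite /row_coords; case: (fintype.split k) => i; [exact: diff_fst_coord | exact: diff_snd_coord].
Qed.

(** A compact set containing the disc of radius B, realised as a continuous image of a real
    rectangle. *)
Definition square_box (B : R) : set C :=
  (fun p : R * R => ofR p.1 + 'i * ofR p.2) @` (`[- B, B] `*` `[- B, B]).

Lemma continuous_ofR : continuous (@ofR R : R -> C).
Proof.
move=> a; apply/cvgrPdist_lt => e e0.
have Ee : e = ofR (modc e) by rewrite -modcE gtr0_norm.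
have e1 : 0 < modc e by rewrite -ofR_lt -Ee ofR0.
near=> b; rewrite Ee -ofRB modc_lt modc_ofR.
near: b; exact: (@cvgr_dist_lt _ _ _ _ _ id).
Unshelve. all: by end_near. Qed.

Lemma compact_square_box B : compact (square_box B).
Proof.
apply: continuous_compact.
  apply: continuous_subspaceT => p.
  apply: cvgD.
    by apply: continuous_comp; [exact: cvg_fst | exact: continuous_ofR].
  apply: cvgM; first exact: cvg_cst.
  by apply: continuous_comp; [exact: cvg_snd | exact: continuous_ofR].
by apply: (@compact_setX R R); exact: segment_compact.
Qed.

Lemma square_boxP B (z : C) : modc z <= B -> square_box B z.
Proof.
move=> zB; exists (complex.Re z, complex.Im z) => /=.
  suff [h1 h2] : `|complex.Re z| <= B /\ `|complex.Im z| <= B.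
    by split; rewrite in_itv /= -ler_norml.
  have h : modc z = Num.sqrt (complex.Re z ^+ 2 + complex.Im z ^+ 2).
    by apply: ofR_inj; rewrite -modcE normc_def.
  by split; apply: le_trans zB; rewrite h -sqrtr_sqr ler_wsqrtr // ?lerDl ?lerDr sqr_ge0.
by rewrite [RHS]complexE.
Qed.

(** Compactness is used on the whole box: near a point with Jhat nonzero the function is continuous,
    hence locally bounded; near a point with Jhat = 0 the condition Jhat = 1 fails. *)
Lemma ev_bounded g (B : R) : holomorphic g -> exists S : R, forall x,
  Jx x = 1 -> (forall i, modc (x i) <= B) -> modc (ev g (xi_of x) (eta_of x)) <= S.
Proof.
move=> hg.
pose A := [set v : 'rV[C]_n.+1 | forall i, square_box B (v 0 i)].
have cA : compact A := (@rV_compact C n.+1 (fun=> square_box B) (fun=> compact_square_box (B := B))).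
have /compact_near_coveringP cov := compact_setX cA cA.
have [|S [_ HS]] := cov R (pinfty_nbhs R) (fun S p => Jhat s p.1 p.2 = 1 ->
    modc (ev g p.1 p.2) <= S).
  move=> p _.
  pose G := fun q => ev g (xi_of (row_coords q)) (eta_of (row_coords q)).
  have [Jp|Jp] := eqVneq (Jhat s p.1 p.2) 0.
    have dJ : differentiable (fun q => 1 - Jhat s q.1 q.2) p.
      apply: diff_sub; first exact: diff_cst.
      apply: diff_bigsum => k _; apply: diff_mul; last exact: diff_snd_coord.
      by apply: diff_mul; [exact: diff_cst | exact: diff_fst_coord].
    have J1 : \forall q \near p, 1 - Jhat s q.1 q.2 != 0.
      by apply: diff_near_neq0 => //; rewrite Jp subr0 oner_neq0.
    near=> q S => /=; move=> Jq; exfalso.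
    suff : 1 - Jhat s q.1 q.2 != 0 by rewrite Jq subrr eqxx.
    by near: q.
  have dG : differentiable G p.
    apply: ev_diff => //; first by move=> k; exact: diff_coords.
    by rewrite /Jx xi_of_coords eta_of_coords.
  have cG := differentiable_continuous dG.
  have near1 : \forall q \near p, `|G p - G q| < 1.
    by apply: (@cvgr_dist_lt _ _ _ _ _ _ _ cG); exact: ltr01.
  near=> q S => /= _.
  have : `|G p - G q| < 1 by near: q.
  rewrite -ofR1 modc_lt => h.
  have -> : ev g q.1 q.2 = G q by rewrite /G xi_of_coords eta_of_coords.
  apply: (@le_trans _ _ (modc (G p) + 1)).
    have := modc_distl (G q) (G p); rewrite modc_subC; lra.
  by near: S; apply: nbhs_pinfty_ge; exact: num_real.
have S1 : S < S + 1 by rewrite ltrDl.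
exists (S + 1) => x J1 xB; apply: (HS _ S1 (xi_of x, eta_of x)) => //.
by split => i /=; rewrite mxE; exact: square_boxP.
Unshelve. all: by end_near. Qed.

End MhatFunctions.

(** * Polynomial approximation of holomorphic functions on Mhat *)

Section MhatApproximation.
Context (R : realType) (n s : nat).
Hypothesis s0 : (0 < s)%N.
Local Notation C := (CC R).
Local Notation d := (n.+1 + n.+1)%N.
Implicit Types (x : 'I_d -> C) (g : Mhat R n s -> C).

Let ix : 'I_d := lshift n.+1 (ord0 : 'I_n.+1).
Let iy : 'I_d := rshift n.+1 (ord0 : 'I_n.+1).

Definition rest x : C := \sum_(k < n.+1 | k != ord0)
  nu R s k * x (lshift n.+1 k) * x (rshift n.+1 k).

Definition on_fibre x a b : 'I_d -> C := upd (upd x ix a) iy b.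

Lemma lshift_neq_rshift (k l : 'I_n.+1) : (lshift n.+1 k == rshift n.+1 l) = false.
Proof. by apply/eqP => /(congr1 val) /= E; have := ltn_ord k; lia. Qed.

Lemma on_fibre_l x a b k :
  on_fibre x a b (lshift n.+1 k) = if k == ord0 then a else x (lshift n.+1 k).
Proof.
by rewrite /on_fibre /upd lshift_neq_rshift (inj_eq (@lshift_inj _ _)).
Qed.

Lemma on_fibre_r x a b k :
  on_fibre x a b (rshift n.+1 k) = if k == ord0 then b else x (rshift n.+1 k).
Proof.
rewrite /on_fibre /upd (inj_eq (@rshift_inj _ _)); by case: ifP.
Qed.

(** The hypothesis [s0] makes nu_0 equal to +1, so the fibre over the other coordinates is a b = 1 -
    rest x. *)
Lemma JxE x : Jx s x = x ix * x iy + rest x.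
Proof.
rewrite /Jx /Jhat (bigD1 ord0) //= !mxE /nu s0 mul1r; congr (_ + _).
by apply: eq_bigr => k _; rewrite !mxE.
Qed.

Lemma rest_on_fibre x a b : rest (on_fibre x a b) = rest x.
Proof.
by apply: eq_bigr => k /negPf k0; rewrite on_fibre_l on_fibre_r k0.
Qed.

Lemma Jx_on_fibre x a b : a * b = 1 - rest x -> Jx s (on_fibre x a b) = 1.
Proof.
move=> ab; rewrite JxE rest_on_fibre on_fibre_l on_fibre_r /= ab.
by rewrite addrC addrCA subrr addr0.
Qed.

Lemma modc_nu (k : 'I_n.+1) : modc (nu R s k) = 1.
Proof. by rewrite /nu; case: ifP => _; rewrite ?modcN modc1. Qed.

Lemma rest_bound x (B : R) : 0 <= B -> (forall i, modc (x i) <= B) ->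
  modc (1 - rest x) <= 1 + (n.+1)%:R * (B * B).
Proof.
move=> B0 xB; apply: le_trans (modcB _ _) _; rewrite modc1 lerD2l.
apply: le_trans (modc_sum _ _ _) _.
have -> : n.+1%:R * (B * B) = \sum_(k < n.+1) B * B.
  by rewrite sumr_const card_ord mulr_natl.
rewrite big_mkcond /=; apply: ler_sum => k _; case: ifP => _.
  by rewrite !modcM modc_nu mul1r; apply: ler_pM; rewrite ?modc_ge0.
by rewrite mulr_ge0.
Qed.

Lemma rest_diff (V : normedModType C) (c : V -> 'I_d -> C) (z : V) :
  (forall k, differentiable (fun y => c y k) z) ->
  differentiable (fun y => rest (c y)) z.
Proof.
move=> dc; apply: diff_bigsum => k _; apply: diff_mul; last exact: dc.
by apply: diff_mul; [exact: diff_cst | exact: dc].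
Qed.

Definition evx g x : C := ev g (xi_of x) (eta_of x).

Lemma on_fibre_diff (V : normedModType C) g (c : V -> 'I_d -> C) (a b : V -> C) z :
  holomorphic g -> (forall k, differentiable (fun y => c y k) z) ->
  differentiable a z -> differentiable b z -> a z * b z = 1 - rest (c z) ->
  differentiable (fun y => evx g (on_fibre (c y) (a y) (b y))) z.
Proof.
move=> hg dc da db ab; apply: (@ev_diff _ _ _ _ _ (fun y => on_fibre (c y) (a y) (b y))) => //.
  by move=> k; rewrite /on_fibre /upd; case: (k == iy) => //; case: (k == ix).
by rewrite Jx_on_fibre // oner_neq0.
Qed.

Lemma on_fibre_bound x a b (B : R) : modc a <= B -> modc b <= B ->
  (forall i, modc (x i) <= B) -> forall i, modc (on_fibre x a b i) <= B.
Proof. by move=> aB bB xB i; rewrite /on_fibre /upd; case: ifP => // _; case: ifP. Qed.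

Lemma upd_diff x k i (z : C) : differentiable (fun w => upd x k w i) z.
Proof.
rewrite /upd; case: (i == k); [exact: diff_id | exact: diff_cst].
Qed.

(** These are the interpolation coefficients at a node l. Since l is nonzero, the point (l, (1 -
    rest x) / l) lies on the conic for every x, so g is evaluated inside its domain throughout. *)
Lemma entire_on_fibre g (l : C) : holomorphic g -> l != 0 ->
  entire (fun x => evx g (on_fibre x l ((1 - rest x) / l))) /\
  entire (fun x => evx g (on_fibre x ((1 - rest x) / l) l)).
Proof.
move=> hg l0.
have dt x k z : differentiable (fun w => (1 - rest (upd x k w)) / l) z.
  apply: diff_mul; last exact: diff_cst.
  apply: diff_sub; first exact: diff_cst.
  by apply: rest_diff => i; exact: upd_diff.
have bnd (B : R) : exists B' : R, forall x, (forall i, modc (x i) <= B) ->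
    [/\ modc l <= B', modc ((1 - rest x) / l) <= B' & forall i, modc (x i) <= B'].
  (* The sum of bounds for the free coordinates, for l and for (1 - rest x) / l; the absolute value
     allows negative B. *)
  exists (`|B| + modc l + (1 + n.+1%:R * (`|B| * `|B|)) / modc l) => x xB.
  have l0' : 0 < modc l by rewrite modc_gt0.
  have nB : 0 <= `|B| by exact: normr_ge0.
  have q0 : 0 <= (1 + n.+1%:R * (`|B| * `|B|)) / modc l.
    by rewrite divr_ge0 ?modc_ge0 // addr_ge0 // mulr_ge0 // mulr_ge0.
  have xB' i : modc (x i) <= `|B| by apply: le_trans (xB i) (ler_norm _).
  have h : modc ((1 - rest x) / l) <= (1 + n.+1%:R * (`|B| * `|B|)) / modc l.
    rewrite modcM modcV; apply: ler_wpM2r; first by rewrite invr_ge0 ltW.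
    exact: rest_bound.
  move: q0 h; set q := (X in 0 <= X) => q0 h.
  have l1 := ltW l0'; split => [||i].
  - by rewrite addrAC lerDr addr_ge0.
  - by apply: le_trans h _; rewrite lerDr addr_ge0.
  - by apply: le_trans (xB' i) _; rewrite -addrA lerDl addr_ge0 // ltW.
split; split.
- move=> x k z; apply: (@on_fibre_diff _ g (upd x k) (fun=> l)
     (fun w => (1 - rest (upd x k w)) / l)) => //.
  + by move=> i; exact: upd_diff.
  + by rewrite mulrC divfK.
- move=> B; have [B' HB'] := bnd B; have [S HS] := ev_bounded B' hg.
  exists S => x /HB' [h1 h2 h3]; apply: HS; last exact: on_fibre_bound.
  by apply: Jx_on_fibre; rewrite mulrC divfK.
- move=> x k z; apply: (@on_fibre_diff _ g (upd x k)
     (fun w => (1 - rest (upd x k w)) / l) (fun=> l)) => //.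
  + by move=> i; exact: upd_diff.
  + by rewrite divfK.
- move=> B; have [B' HB'] := bnd B; have [S HS] := ev_bounded B' hg.
  exists S => x /HB' [h1 h2 h3]; apply: HS; last exact: on_fibre_bound.
  by apply: Jx_on_fibre; rewrite divfK.
Qed.

Lemma on_fibre_id x : on_fibre x (x ix) (x iy) = x.
Proof. by rewrite /on_fibre upd_id /upd; apply/funext => i; case: eqP => [->|]. Qed.

Lemma holomorphic_approx g (B e : R) : holomorphic g -> 0 < B -> 0 < e ->
  exists2 P : ('I_d -> C) -> C, polynomial_fun P &
    forall x, Jx s x = 1 -> (forall i, modc (x i) <= B) ->
      modc (evx g x - P x) <= e.
Proof.
move=> hg B0 e0; have [S HS] := ev_bounded (3 * (4 * B)) hg.
have e2 : 0 < e / 2 by rewrite divr_gt0.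
have [N HN] := pow_small (S * 16) e2; set M := (2 ^ N)%N in HN.
have M0 : 0 < M%:R :> R by rewrite ltr0n expn_gt0.
(* Replacing coefficients by polynomials costs e' * M in the first average and e' * (M + 1) in the
   second, together e / 2; the other half is the interpolation error. *)
pose e' := e / (2 * (2 * M%:R + 1)).
have e'0 : 0 < e' by rewrite divr_gt0 //; lra.
have node0 j : @node R N B j != 0 by exact: node_neq0'.
have /choice[P HP] (j : 'I_M) : exists P : ('I_d -> C) -> C, polynomial_fun P /\
    forall x, (forall i, modc (x i) <= B) ->
    modc (evx g (on_fibre x (node B j) ((1 - rest x) / node B j)) - P x) <= e'.
  have [h _] := entire_on_fibre hg (node0 j).
  by have [P pP HP] := entire_approx h B0 e'0; exists P.
have /choice[Q HQ] (j : 'I_M) : exists Q : ('I_d -> C) -> C, polynomial_fun Q /\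
    forall x, (forall i, modc (x i) <= B) ->
    modc (evx g (on_fibre x ((1 - rest x) / node B j) (node B j)) - Q x) <= e'.
  have [_ h] := entire_on_fibre hg (node0 j).
  by have [Q pQ HQ] := entire_approx h B0 e'0; exists Q.
have geomP i j : polynomial_fun (fun x => geom M (x i / @node R N B j)).
  apply: polynomial_sum => m; apply: polynomial_exp.
  by apply: polynomial_mul; [exact: polynomial_coord | exact: polynomial_cst].
exists (fun x => (\sum_(j < M) P j x * geom M (x ix / node B j)) / M%:R +
    (\sum_(j < M) Q j x * (geom M (x iy / node B j) + - 1)) / M%:R).
  apply: polynomial_add; apply: polynomial_mul; try exact: polynomial_cst;
    apply: polynomial_sum => j; apply: polynomial_mul; try exact: geomP.
  - by have [] := HP j.
  - by have [] := HQ j.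
  - by apply: polynomial_add => //; exact: polynomial_cst.
move=> x J1 xB; pose Phi a b := evx g (on_fibre x a b).
have txy : x ix * x iy = 1 - rest x by rewrite -J1 JxE addrK.
have h1 := @fibre_approx R N B B0 Phi (x ix) (x iy) S (xB ix) (xB iy).
have {}h1 : modc (evx g x - (gavg N B (fun l => Phi l (x ix * x iy / l) * geom M (x ix / l))
    + gavg N B (fun l => Phi (x ix * x iy / l) l * (geom M (x iy / l) - 1)))) <= e / 2.
  rewrite -[X in evx g X](on_fibre_id x).
  apply: le_trans HN; rewrite -mulrA; apply: h1.
  - move=> u u0; apply: (@on_fibre_diff _ g (fun=> x) id (fun u => x ix * x iy / u)).
    + exact: hg.
    + by move=> k; exact: diff_cst.
    + exact: diff_id.
    + by apply: diff_mul; [exact: diff_cst | apply: diff_inv; [exact: u0 | exact: diff_id]].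
    + by rewrite txy mulrC divfK.
  - move=> t0 u; have r1 : 1 - rest x = 0 by rewrite -txy.
    split; [apply: (@on_fibre_diff _ g (fun=> x) id (fun=> 0)) => //
           |apply: (@on_fibre_diff _ g (fun=> x) (fun=> 0) id) => //];
    by rewrite r1 ?mulr0 ?mul0r.
  - move=> a b ab aB bB; apply: HS; first by apply: Jx_on_fibre; rewrite ab.
    apply: on_fibre_bound => // i; apply: le_trans (xB i) _.
    by move: B0; lra.
have nodeB i j : modc (x i / @node R N B j) <= 1.
  rewrite modcM modcV modc_node // ler_pdivrMr; last by move: B0; lra.
  by apply: le_trans (xB i) _; move: B0; lra.
have h2 : modc (gavg N B (fun l => Phi l (x ix * x iy / l) * geom M (x ix / l))
    - (\sum_(j < M) P j x * geom M (x ix / node B j)) / M%:R) <= e' * M%:R.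
  rewrite /gavg -mulrBl -sumrB modcM modcV modc_nat ler_pdivrMr //.
  apply: le_trans (modc_sum _ _ _) _.
  have -> : e' * M%:R * M%:R = \sum_(j < M) e' * M%:R.
    by rewrite sumr_const card_ord -[RHS]mulr_natr.
  apply: ler_sum => j _; rewrite -mulrBl modcM; apply: ler_pM; rewrite ?modc_ge0 //.
    by rewrite /Phi txy; have [_] := HP j; apply.
  by apply: modc_geom; exact: nodeB.
have h3 : modc (gavg N B (fun l => Phi (x ix * x iy / l) l * (geom M (x iy / l) - 1))
    - (\sum_(j < M) Q j x * (geom M (x iy / node B j) + - 1)) / M%:R)
    <= e' * (M%:R + 1).
  rewrite /gavg -mulrBl -sumrB modcM modcV modc_nat ler_pdivrMr //.
  apply: le_trans (modc_sum _ _ _) _.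
  have -> : e' * (M%:R + 1) * M%:R = \sum_(j < M) e' * (M%:R + 1).
    by rewrite sumr_const card_ord -[RHS]mulr_natr.
  apply: ler_sum => j _; rewrite -mulrBl modcM; apply: ler_pM; rewrite ?modc_ge0 //.
    by rewrite /Phi txy; have [_] := HQ j; apply.
  apply: le_trans (modcB _ _) _; rewrite modc1 lerD2r.
  by apply: modc_geom; exact: nodeB.
move: h1 h2 h3; set g1 := gavg _ _ _; set g2 := gavg _ _ _.
set p1 := (\sum_(j < M) P j x * _) / _; set p2 := (\sum_(j < M) Q j x * _) / _ => h1 h2 h3.
have -> : evx g x - (p1 + p2) = evx g x - (g1 + g2) + ((g1 - p1) + (g2 - p2)) by ring.
have e'E : e' * M%:R + e' * (M%:R + 1) = e / 2.
  by rewrite /e'; field; lra.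
apply: le_trans (modcD _ _) _; have := modcD (g1 - p1) (g2 - p2); lra.
Qed.

End MhatApproximation.

(** * Invariant polynomials *)

Section Balanced.
Context (R : realType) (n : nat).
Local Notation C := (CC R).
Local Notation d := (n.+1 + n.+1)%N.
Implicit Types (x : 'I_d -> C) (p : mpoly.mpoly d C) (a : C).

Definition act a x : 'I_d -> C :=
  fun k => (if fintype.split k then a else a^-1) * x k.

Definition degl (m : mpoly.multinom d) : nat := \sum_(i < n.+1) m (lshift n.+1 i).
Definition degr (m : mpoly.multinom d) : nat := \sum_(i < n.+1) m (rshift n.+1 i).

(** The C^*-invariant part of p: under [act] a monomial has weight [degl] - [degr], and those of
    weight 0 are kept. *)
Definition balanced p : mpoly.mpoly d C :=
  \sum_(m <- mpoly.msupp p | degl m == degr m)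
    mpoly.mcoeff m p *: mpoly.mpolyX C m.

Definition mon (m : mpoly.multinom d) x : C := \prod_i x i ^+ m i.

Lemma balancedE p x : mpoly.meval x (balanced p) =
  \sum_(m <- mpoly.msupp p | degl m == degr m) mpoly.mcoeff m p * mon m x.
Proof.
rewrite raddf_sum; apply: eq_bigr => m _.
by rewrite /= mpoly.mevalZ mpoly.mevalX.
Qed.

Lemma mon_act m a x : mon m (act a x) = a ^+ degl m * a^-1 ^+ degr m * mon m x.
Proof.
rewrite /mon /act; under eq_bigr do rewrite exprMn.
rewrite big_split /=; congr (_ * _).
rewrite big_split_ord /=; congr (_ * _); rewrite /degl /degr -prodrXr;
  apply: eq_bigr => i _.
- by rewrite (unsplitK (inl i)).
- by rewrite (unsplitK (inr i)).
Qed.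

Lemma balanced_act p a x : a != 0 ->
  mpoly.meval (act a x) (balanced p) = mpoly.meval x (balanced p).
Proof.
move=> a0; rewrite !balancedE; apply: eq_bigr => m /eqP E.
by rewrite mon_act E -exprMn divff // expr1n mul1r.
Qed.

(** For one polynomial the mean over U(1) is a finite mean over M-th roots of unity: once M exceeds
    all the degrees, a nonzero weight is not divisible by M and averages to 0. *)
Lemma balanced_avg p : exists2 M : nat, (0 < M)%N & forall x,
  mpoly.meval x (balanced p) =
  avg M (turn M%:R^-1) 1 (fun a => mpoly.meval (act a x) p).
Proof.
pose M := (\sum_(m <- mpoly.msupp p) (degl m + degr m)).+1.
have M0 : (0 < M)%N by [].
have wP : M.-primitive_root (turn M%:R^-1 : C) := turn_prim M0.
have o0 : (1 : C) != 0 := oner_neq0 _.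
exists M => // x.
transitivity (avg M (turn M%:R^-1) 1 (fun a => \sum_(m <- mpoly.msupp p)
    mpoly.mcoeff m p * mon m x * (a ^+ degl m * a ^- degr m))); last first.
  apply: eq_avg => j; rewrite mpoly.mevalE; apply: eq_bigr => m _.
  by rewrite -/(mon m _) mon_act exprVn; ring.
rewrite avg_sum balancedE big_mkcond /= big_seq [RHS]big_seq.
apply: eq_bigr => m mp; rewrite avgZ.
have mM : (degl m + degr m < M)%N.
  by rewrite ltnS (big_rem m) //= leq_addr.
have -> : avg M (turn M%:R^-1) 1 (fun a => a ^+ degl m * a ^- degr m) =
    (degl m == degr m)%:R.
  (* Adding M to the exponent avoids negative powers, as a^M = 1 at the nodes. *)
  transitivity (avg M (turn M%:R^-1) (1 : C) (fun a => a ^+ (degl m + (M - degr m)))).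
    apply: eq_avg => j; rewrite node_exprV //; last lia.
    by rewrite expr1n divr1 exprD.
  rewrite avg_expr // expr1n mulr1; congr (_%:R); congr nat_of_bool.
  apply/idP/eqP => [/dvdnP[q E]|->].
    by case: q E => [|[|q]] E; nia.
  by rewrite subnKC ?dvdnn //; lia.
by case: eqP => _; rewrite ?mulr1 ?mulr0.
Qed.

Lemma meval_diff (V : normedModType C) p (c : V -> 'I_d -> C) (z : V) :
  (forall k, differentiable (fun y => c y k) z) ->
  differentiable (fun y => mpoly.meval (c y) p) z.
Proof.
move=> dc; rewrite (_ : (fun y => _) = fun y => \sum_(m <- mpoly.msupp p)
    mpoly.mcoeff m p * \prod_i c y i ^+ m i); last first.
  by apply/funext => y; rewrite mpoly.mevalE.
apply: diff_bigsum => m _; apply: diff_mul; first exact: diff_cst.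
by apply: diff_bigprod => i _; exact: diff_exp.
Qed.

End Balanced.

(** * Balanced polynomials as holomorphic functions on Mhat *)

Section PolynomialsOnMhat.
Context (R : realType) (n s : nat).
Local Notation C := (CC R).
Local Notation d := (n.+1 + n.+1)%N.
Implicit Types (p : mpoly.mpoly d C) (x : 'I_d -> C).

Lemma act_coords a (q : 'rV[C]_n.+1 * 'rV[C]_n.+1) :
  act a (row_coords q) = row_coords (a *: q.1, a^-1 *: q.2).
Proof.
by apply/funext => k; rewrite /act /row_coords; case: fintype.split => i /=;
  rewrite mxE.
Qed.

Lemma Jx_act a x : a != 0 -> Jx s (act a x) = Jx s x.
Proof.
move=> a0; rewrite /Jx -[RHS]mul1r -(divff a0) -JhatZ; congr Jhat.
- by apply/rowP => k; rewrite !mxE /act (unsplitK (inl k)).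
- by apply/rowP => k; rewrite !mxE /act (unsplitK (inr k)).
Qed.

Lemma evx_act (g : Mhat R n s -> C) a x : a != 0 -> evx g (act a x) = evx g x.
Proof.
move=> a0; have a0' : a^-1 != 0 by rewrite invr_eq0.
have xiE : xi_of (act a x) = a *: xi_of x.
  by apply/rowP => k; rewrite !mxE /act (unsplitK (inl k)).
have etaE : eta_of (act a x) = a^-1 *: eta_of x.
  by apply/rowP => k; rewrite !mxE /act (unsplitK (inr k)).
by rewrite /evx /ev xiE etaE Mhat_point_scale.
Qed.

Definition mhat_poly p (m : Mhat R n s) : C :=
  mpoly.meval (row_coords (sval (repr m))) (balanced p).

Lemma mhat_polyE p (y : Zhat R n s) :
  mhat_poly p (\pi_(Mhat R n s) y) = mpoly.meval (row_coords (sval y)) (balanced p).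
Proof.
rewrite /mhat_poly; case: piP => y' /eqmodP /asboolP[a [a0 ->]].
by rewrite -act_coords balanced_act.
Qed.

Lemma ev_mhat_poly p xi eta : Jhat s xi eta != 0 ->
  ev (mhat_poly p) xi eta =
  mpoly.meval (row_coords ((Jhat s xi eta)^-1 *: xi, eta)) (balanced p).
Proof.
move=> J0.
have J1 : Jhat s ((Jhat s xi eta)^-1 *: xi) eta = 1.
  by rewrite -[eta in X in Jhat _ _ X]scale1r JhatZ mulr1 mulVf.
rewrite /ev /Mhat_point (insubT (fun q => q \in Zhat R n s) (ZhatP J1)) /=.
by rewrite mhat_polyE.
Qed.

Lemma affine_diff (V : normedModType C) (i : 'I_n.+1) (u : V -> 'rV[C]_n) k z :
  differentiable u z -> differentiable (fun y => affine i (u y) 0 k) z.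
Proof.
move=> du; have [[j ->]|->] : (exists j, k = lift i j) \/ k = i.
  by case: (unliftP i k) => [j ->|->]; [left; exists j | right].
- rewrite (_ : (fun y => _) = fun y => u y 0 j).
    apply: (@differentiable_comp _ _ _ _ u (fun M : 'rV[C]_n => M 0 j)) => //.
    exact: differentiable_coord.
  by apply/funext => y; rewrite mxE liftK.
- rewrite (_ : (fun y => _) = fun=> 1); first exact: diff_cst.
  by apply/funext => y; rewrite mxE unlift_none.
Qed.

(** In a chart, near a point of its domain, the function is a polynomial in the affine coordinates
    and 1 / Jhat. *)
Lemma mhat_poly_holomorphic p : holomorphic (mhat_poly p).
Proof.
move=> i j w Jw.
have d1 k : differentiable
    (fun q : 'rV[C]_n * 'rV[C]_n => affine i q.1 0 k) w.
  by apply: affine_diff; apply: linear_differentiable => q; exact: cvg_fst.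
have d2 k : differentiable
    (fun q : 'rV[C]_n * 'rV[C]_n => affine j q.2 0 k) w.
  by apply: affine_diff; apply: linear_differentiable => q; exact: cvg_snd.
have dJ : differentiable (fun q : 'rV[C]_n * 'rV[C]_n =>
    Jhat s (affine i q.1) (affine j q.2)) w.
  apply: diff_bigsum => k _; apply: diff_mul; last exact: d2.
  by apply: diff_mul; [exact: diff_cst | exact: d1].
apply: (@near_eq_differentiable _ _ _ (fun q : 'rV[C]_n * 'rV[C]_n =>
   mpoly.meval (row_coords ((Jhat s (affine i q.1) (affine j q.2))^-1 *: affine i q.1,
      affine j q.2)) (balanced p))).
  have := diff_near_neq0 dJ Jw; apply: filterS => q Jq.
  by rewrite -ev_mhat_poly.
apply: meval_diff => k; rewrite /row_coords /=; case: fintype.split => l //.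
rewrite (_ : (fun y => _) = fun q : 'rV[C]_n * 'rV[C]_n =>
   (Jhat s (affine i q.1) (affine j q.2))^-1 * affine i q.1 0 l); last first.
  by apply/funext => q; rewrite mxE.
by apply: diff_mul; [exact: diff_inv | exact: d1].
Qed.

Lemma row_coords_mx (z y : 'rV[C]_n.+1) : row_coords (z, y) = row_mx z y 0.
Proof. by apply/funext => k; rewrite /row_coords mxE; case: fintype.split. Qed.

Lemma poly_eval_act p a (z : 'rV[C]_n.+1) : `|a| = 1 ->
  poly_eval p (a *: z) = mpoly.meval (act a (row_coords (z, conj_row z))) p.
Proof.
move=> a1; have a0 : a != 0 by rewrite -normr_eq0 a1 oner_neq0.
have aV : a^* = a^-1 by apply: (mulfI a0); rewrite divff // -normCK a1 expr1n.
rewrite /poly_eval act_coords row_coords_mx; congr (mpoly.meval (row_mx _ _ 0) p).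
by apply/rowP => k; rewrite !mxE rmorphM /= aV.
Qed.

Lemma norm_turn_root (M j : nat) : `|1 * turn M%:R^-1 ^+ j : C| = 1.
Proof. by rewrite mul1r modcE modcX modc_turn expr1n ofR1. Qed.

(** For |a| = 1 the conjugate of a is a^-1, so on points (z, conj z) the action of U(1) is [act].
    Invariance makes the value of p there equal to its average, which is the value of the balanced
    part. *)
Lemma U1_invariant_balanced p (z : 'rV[C]_n.+1) : U1_invariant p ->
  poly_eval p z = mpoly.meval (row_coords (z, conj_row z)) (balanced p).
Proof.
move=> pU; have [M M0 ->] := balanced_avg p.
transitivity (avg M (turn M%:R^-1) 1 (fun=> poly_eval p z)).
  by rewrite /avg sumr_const card_ord -[X in _ = X / _]mulr_natr mulfK // pnatr_eq0 -lt0n.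
by apply: eq_avg => j; rewrite -poly_eval_act ?pU // norm_turn_root.
Qed.

Lemma balanced_U1_invariant p : U1_invariant (balanced p).
Proof.
move=> a z a1; have a0 : a != 0 by rewrite -normr_eq0 a1 oner_neq0.
by rewrite (poly_eval_act _ _ a1) (balanced_act _ _ a0) row_coords_mx.
Qed.

(** Both conditions on x and the value of g are preserved by [act a] for |a| = 1, so averaging does
    not increase the error. *)
Lemma balanced_approx (g : Mhat R n s -> C) p (B e : R) :
  (forall x, Jx s x = 1 -> (forall i, modc (x i) <= B) ->
     modc (evx g x - mpoly.meval x p) <= e) ->
  forall x, Jx s x = 1 -> (forall i, modc (x i) <= B) ->
     modc (evx g x - mpoly.meval x (balanced p)) <= e.
Proof.
move=> H x J1 xB; have [M M0 ->] := balanced_avg p.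
have M0' : 0 < M%:R :> R by rewrite ltr0n.
have -> : evx g x = avg M (turn M%:R^-1) 1 (fun=> evx g x).
  by rewrite /avg sumr_const card_ord -[X in _ = X / _]mulr_natr mulfK // pnatr_eq0 -lt0n.
rewrite /avg -mulrBl -sumrB modcM modcV modc_nat ler_pdivrMr //.
apply: le_trans (modc_sum _ _ _) _.
have -> : e * M%:R = \sum_(j < M) e by rewrite sumr_const card_ord -[RHS]mulr_natr.
apply: ler_sum => j _; set a := 1 * _ ^+ _.
have a1 : modc a = 1 by apply: ofR_inj; rewrite -modcE norm_turn_root ofR1.
have a0 : a != 0 by rewrite -modc_gt0 a1.
rewrite -(evx_act g x a0); apply: H; first by rewrite Jx_act.
move=> i; rewrite /act; case: (fintype.split i) => ? /=.
  by rewrite modcM a1 mul1r.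
by rewrite modcM modcV a1 invr1 mul1r.
Qed.

End PolynomialsOnMhat.

(** * Compact subsets of Mhat and density *)

Section CompactSubsets.
Context (R : realType) (n s : nat).
Local Notation C := (CC R).
Local Notation d := (n.+1 + n.+1)%N.

(** The products xi_i eta_j are invariant under C^* and so descend to continuous functions on the
    quotient, bounded on compact sets. *)
Definition moment (i j : 'I_n.+1) (m : Mhat R n s) : C :=
  (sval (repr m)).1 0 i * (sval (repr m)).2 0 j.

Lemma momentE i j (y : Zhat R n s) :
  moment i j (\pi_(Mhat R n s) y) = (sval y).1 0 i * (sval y).2 0 j.
Proof.
rewrite /moment; case: piP => y' /eqmodP /asboolP[a [a0 ->]].
by rewrite /= !mxE mulrACA divff // mul1r.
Qed.

Lemma moment_continuous i j : continuous (moment i j).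
Proof.
apply/quotient_continuous => y.
rewrite (_ : moment i j \o _ = (fun q : 'rV[C]_n.+1 * 'rV[C]_n.+1 =>
  q.1 0 i * q.2 0 j) \o (@sval _ _ : Zhat R n s -> _)); last first.
  by apply/funext => z /=; rewrite momentE.
apply: continuous_comp; first exact: initial_continuous.
apply: differentiable_continuous; apply: diff_mul.
  exact: diff_fst_coord.
exact: diff_snd_coord.
Qed.

Lemma moment_bounded i j (K : set (Mhat R n s)) : compact K ->
  exists S : R, forall m, K m -> modc (moment i j m) <= S.
Proof.
move=> /compact_near_coveringP cov.
have [|S [_ HS]] := cov R (pinfty_nbhs R) (fun S m => modc (moment i j m) <= S).
  move=> m _; have near1 : \forall q \near m, `|moment i j m - moment i j q| < 1.
    by apply: (@cvgr_dist_lt _ _ _ _ _ _ _ (@moment_continuous i j m)); exact: ltr01.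
  near=> q S.
  have mS : modc (moment i j m) + 1 <= S.
    by near: S; apply: nbhs_pinfty_ge; exact: num_real.
  have : `|moment i j m - moment i j q| < 1 by near: q.
  rewrite -ofR1 modc_lt => h.
  by have := modc_distl (moment i j q) (moment i j m); rewrite modc_subC /=; lra.
have S1 : S < S + 1 by rewrite ltrDl.
by exists (S + 1) => m Km; exact: (HS _ S1 m Km).
Unshelve. all: by end_near. Qed.

(** Scaling the largest xi_i0 to 1 bounds all xi_i by 1 and turns eta_j into the moment xi_i0 eta_j,
    which is bounded on K. *)
Lemma compact_representative (K : set (Mhat R n s)) : compact K ->
  exists B : R, forall m, K m -> exists x : 'I_d -> C,
    [/\ Jx s x = 1, forall i, modc (x i) <= B &
        forall g : Mhat R n s -> C, evx g x = g m].
Proof.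
move=> cK.
have /choice[S HS] (ij : 'I_n.+1 * 'I_n.+1) : exists S : R, forall m, K m ->
    modc (moment ij.1 ij.2 m) <= S by exact: moment_bounded.
exists (1 + \sum_ij `|S ij|) => m Km.
pose y := repr m; have my : m = \pi_(Mhat R n s) y by rewrite reprK.
pose xi := (sval y).1; pose eta := (sval y).2.
have J1 : Jhat s xi eta = 1 by have := valP y; rewrite inE.
have [i0 _ Hmax] := @arg_maxP _ R _ (ord0 : 'I_n.+1) xpredT (fun i => modc (xi 0 i)) isT.
have xi0 : xi 0 i0 != 0.
  apply/eqP => E; have := J1; rewrite /Jhat big1 => [/esym/eqP|k _].
    by rewrite oner_eq0.
  suff -> : xi 0 k = 0 by rewrite mulr0 mul0r.
  apply/eqP; rewrite -modc_eq0 eq_le modc_ge0 andbT.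
  by have := Hmax k isT; rewrite E modc0.
have a0 : (xi 0 i0)^-1 != 0 by rewrite invr_eq0.
exists (act (xi 0 i0)^-1 (row_coords (xi, eta))); split.
- by rewrite Jx_act // /Jx xi_of_coords eta_of_coords.
- have S0 : 0 <= \sum_ij `|S ij| by apply: sumr_ge0.
  move=> k; rewrite /act /row_coords; case: (fintype.split k) => i /=.
    rewrite modcM modcV mulrC ler_pdivrMr ?modc_gt0 //.
    apply: le_trans (Hmax i isT) _; rewrite ler_peMl ?modc_ge0 //; lra.
  rewrite invrK; have := HS (i0, i) m Km; rewrite /= {1}my momentE => h.
  apply: le_trans h _; apply: le_trans (ler_norm _) _.
  rewrite (bigD1 (i0, i)) //=.
  have : 0 <= \sum_(ij | ij != (i0, i)) `|S ij| by apply: sumr_ge0.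
  move: (\sum_(_ | _) _) `|_| => a b; lra.
- move=> g; rewrite evx_act // /evx /ev xi_of_coords eta_of_coords Mhat_point_Zhat /=.
  rewrite my; congr (g (\pi_(Mhat R n s) _)); apply: val_inj => /=.
  by rewrite /xi /eta -surjective_pairing.
Qed.

End CompactSubsets.

(** * Density of the polynomials *)

Section Density.
Context (R : realType) (n s : nat).
Hypothesis s0 : (0 < s)%N.
Local Notation C := (CC R).

Lemma row_coords_of (x : 'I_(n.+1 + n.+1) -> C) :
  row_coords (xi_of x, eta_of x) = x.
Proof.
apply/funext => k; rewrite /row_coords -{2}(splitK k).
by case: (fintype.split k) => i /=; rewrite mxE.
Qed.

(** The k-th polynomial has accuracy 1 / (k + 1) on the polydisc of radius k + 1, so a single
    sequence converges uniformly on every compact set. *)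
Lemma mhat_poly_dense (g : Mhat R n s -> C) : holomorphic g ->
  exists p : nat -> mpoly.mpoly (n.+1 + n.+1) C,
    {family compact, (fun k => mhat_poly (p k)) @ \oo --> g}.
Proof.
move=> hg.
have /choice[p Hp] (k : nat) : exists p : mpoly.mpoly (n.+1 + n.+1) C,
    forall x, Jx s x = 1 -> (forall i, modc (x i) <= k.+1%:R) ->
      modc (evx g x - mpoly.meval x (balanced p)) <= k.+1%:R^-1.
  have k0 : 0 < k.+1%:R :> R by rewrite ltr0n.
  have k1 : 0 < k.+1%:R^-1 :> R by rewrite invr_gt0.
  have [P [p pE] HP] := holomorphic_approx s0 hg k0 k1.
  exists p; apply: balanced_approx => x J1 xB; rewrite -pE; exact: HP.
exists p; apply/fam_cvgP => K cK.
have [B HB] := compact_representative cK.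
move=> Q /uniform_nbhs[E [entE EQ]].
move: entE; rewrite -entourage_ballE => -[e e0 eE].
have Ee : e = ofR (modc e) by rewrite -modcE gtr0_norm.
have me : 0 < modc e by rewrite -ofR_lt -Ee ofR0.
suff : \forall k \near \oo, Q (mhat_poly (p k)) by [].
near=> k; apply: EQ => m Km; apply: eE => /=.
rewrite -ball_normE /= Ee modc_lt.
have [x [J1 xB xg]] := HB m Km.
rewrite -!xg.
have kB : B <= k.+1%:R.
  apply: (@le_trans _ _ k%:R); last by rewrite ler_nat.
  by near: k; exact: nbhs_infty_ger.
have ke : k.+1%:R^-1 < modc e.
  near: k; exact: (near_infty_natSinv_lt (PosNum me)).
apply: le_lt_trans ke.
have -> : evx (mhat_poly (p k) : Mhat R n s -> C) x = mpoly.meval x (balanced (p k)).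
  have J0 : Jhat s (xi_of x) (eta_of x) != 0 by rewrite -/(Jx s x) J1 oner_neq0.
  rewrite [LHS](ev_mhat_poly (p k) J0) -/(Jx s x) J1 invr1 scale1r.
  by rewrite row_coords_of.
by apply: Hp => // i; exact: le_trans (xB i) kB.
Unshelve. all: by end_near. Qed.

End Density.

Theorem corollary4p17 (R : realType) (n s : nat)
  (hn : (1 <= n)%N) (hs : (1 <= s <= n.+1)%N) :
  calP R n s `<=` calA R n s /\
  dense [set f : A_space R n s | calP R n s (sval f)].
Proof.
have s0 : (0 < s)%N by case/andP: hs.
have restrP (p : mpoly.mpoly (n.+1 + n.+1) (CC R)) (z : Z R n s) :
    mhat_poly p (Delta_red (\pi_(Mred R n s) z)) =
    mpoly.meval (row_coords (sval z, conj_row (sval z))) (balanced p).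
  by rewrite Delta_redE mhat_polyE.
split.
  (* The holomorphic extension of an invariant polynomial is given by its balanced part, which
     agrees with it at (z, conj z). *)
  move=> f [p pU Hf]; exists (mhat_poly p); first exact: mhat_poly_holomorphic.
  apply/funext => m; rewrite -[m]reprK /= restrP Hf.
  by rewrite U1_invariant_balanced.
move=> U [f Uf] oU.
have [g hg gf] : exists2 g, holomorphic g & g \o @Delta_red R n s = sval f.
  by case: f Uf => f /= fA _; case: (set_mem fA) => g hg <-; exists g.
have [p Hp] := mhat_poly_dense s0 hg.
have hO h : holomorphic h -> h \in @calO R n s.
  by move=> hh; exact: mem_set.
pose G : @calO R n s := exist _ g (hO _ hg).
pose P k : @calO R n s := exist _ (mhat_poly (p k)) (hO _ (mhat_poly_holomorphic (p k))).
have UG : U (Defs.restrict G).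
  by suff -> : Defs.restrict G = f by []; apply: val_inj.
have oV : open ((@Defs.restrict R n s) @^-1` U) by exact: oU.
(* An open set of [calO] is the trace of an open set [W] of the ambient function space, where the
   convergence [Hp] takes place. *)
have [W oW WE] := oV.
have Wg : W g by have : (set_val @^-1` W) G by rewrite WE.
have : \forall k \near \oo, W (mhat_poly (p k)).
  by apply: Hp; exact: open_nbhs_nbhs.
move=> [k _ /(_ k (leqnn k)) Wk].
have Uk : U (Defs.restrict (P k)).
  by have : (Defs.restrict (n := n) (s := s) @^-1` U) (P k) by rewrite -WE.
exists (Defs.restrict (P k)); split=> //=.
exists (balanced (p k)); first exact: balanced_U1_invariant.
by move=> z; rewrite /= restrP /poly_eval row_coords_mx.
Qed.
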